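(* There exist problem-independent (absolute) constants $C, C_1, C_2>0$ such that the following holds. Let $\epsilon,\delta\in(0,1)$, let $r\le d\le n$ and $m\le n$ be positive integers, and let $E>0$ satisfy $$C\le E\le \frac{2e^{4r}}{[4r+\log(1/\delta)]\,\delta},\qquad m\ge E\,C_2^{-2}\epsilon^{-2}\,[4r+\log(1/\delta)].$$ Then for any matrix $A\in\mathbb{R}^{n\times d}$ with rank $r$ and $\mu(A)\le\bar\mu(\epsilon,\delta)$, where $$\bar\mu(\epsilon,\delta):=C_1\sqrt{C_2}\sqrt{\epsilon}\,\min\left\{\frac{\log(E/(C_2\epsilon))}{4r+\log(1/\delta)},\ \sqrt{\frac{\log(E)}{4r+\log(1/\delta)}}\right\},$$ a randomly generated $1$-hashing matrix $S\in\mathbb{R}^{m\times n}$ is an $\epsilon$-subspace embedding for $A$ with probability at least $1-\delta$.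
   Context: Compact SVD: a matrix $A\in\mathbb{R}^{n\times d}$ of rank $r$ is written $A=U\Sigma V^T$ with $U\in\mathbb{R}^{n\times r}$, $V\in\mathbb{R}^{d\times r}$ having orthonormal columns and $\Sigma\in\mathbb{R}^{r\times r}$ diagonal with strictly positive diagonal entries. Coherence: $\mu(A)=\max_{1\le i\le n}\|U_i\|_2$, where $U_i$ is the $i$th row of $U$. $\epsilon$-subspace embedding: $S\in\mathbb{R}^{m\times n}$ is an $\epsilon$-subspace embedding for $B\in\mathbb{R}^{n\times k}$ if $(1-\epsilon)\|y\|_2^2\le\|Sy\|_2^2\le(1+\epsilon)\|y\|_2^2$ for all $y\in\{Bz: z\in\mathbb{R}^k\}$. $1$-hashing matrix: a random matrix $S\in\mathbb{R}^{m\times n}$ such that, independently for each column $j\in\{1,\dots,n\}$, one samples a row index $i\in\{1,\dots,m\}$ uniformly at random and sets $S_{ij}=\pm1$ (independent uniformly random sign), all other entries of the column being $0$. *)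

(* Defs.v *)
From mathcomp Require Export all_boot all_order all_algebra.
From mathcomp Require Export all_classical all_reals all_analysis.

Set Implicit Arguments.
Unset Strict Implicit.
Unset Printing Implicit Defensive.

Import Order.TTheory GRing.Theory Num.Theory.

Local Open Scope classical_set_scope.
Local Open Scope ring_scope.

(* The Euclidean norm; the norm that MathComp-Analysis puts on matrices is the
   sup norm.  It is used both for column vectors and for rows. *)
Definition norm2 (R : realType) (p q : nat) (x : 'M[R]_(p, q)) : R :=
  Num.sqrt (\sum_i \sum_j x i j ^+ 2).

Definition compact_svd (R : realType) (n d r : nat) (A : 'M[R]_(n, d))
    (U : 'M[R]_(n, r)) (Sigma : 'M[R]_r) (V : 'M[R]_(d, r)) : Prop :=
  [/\ A = U *m Sigma *m V^T,
      U^T *m U = 1%:M,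
      V^T *m V = 1%:M,
      is_diag_mx Sigma
    & forall i, 0 < Sigma i i].

(* The maximum of the row norms, which are nonnegative, so that 0 is a neutral
   starting value for the iterated maximum. *)
Definition max_row_norm (R : realType) (n r : nat) (U : 'M[R]_(n, r)) : R :=
  \big[Num.max/0]_(i < n) norm2 (row i U).

(* Every real matrix has a compact SVD, and the row norms of U do not depend on
   which one is used (U is determined up to right multiplication by an
   orthogonal matrix), so the set below is a singleton and the default value 0
   of xget is never used. *)
Definition coherence (R : realType) (n d : nat) (A : 'M[R]_(n, d)) : R :=
  xget 0 [set mu | exists (U : 'M[R]_(n, \rank A)) (Sigma : 'M[R]_(\rank A))
                          (V : 'M[R]_(d, \rank A)),
                     compact_svd A U Sigma V /\ mu = max_row_norm U].

Definition subspace_embedding (R : realType) (m n k : nat) (eps : R)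
    (S : 'M[R]_(m, n)) (B : 'M[R]_(n, k)) : Prop :=
  forall y : 'cV[R]_n, (exists z : 'cV[R]_k, y = B *m z) ->
    (1 - eps) * norm2 y ^+ 2 <= norm2 (S *m y) ^+ 2 <=
    (1 + eps) * norm2 y ^+ 2.

(* h j is the row index sampled in column j, and (-1) ^+ s j its sign.  The
   product rule states mutual independence of the 2n variables h j, s j: taking
   H j or B j to be setT gives the rule for every subfamily. *)
Definition hashing1 (R : realType) (disp : measure_display)
    (T : measurableType disp) (P : probability T R) (m n : nat)
    (S : T -> 'M[R]_(m, n)) : Prop :=
  exists (h : 'I_n -> T -> 'I_m) (s : 'I_n -> T -> bool),
    [/\ (forall j (H : set 'I_m), measurable (h j @^-1` H)) /\
        (forall j (B : set bool), measurable (s j @^-1` B)),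
        forall j i, P (h j @^-1` [set i]) = (m%:R^-1)%:E,
        forall j b, P (s j @^-1` [set b]) = (2^-1)%:E,
        forall (H : 'I_n -> set 'I_m) (B : 'I_n -> set bool),
          P (\bigcap_(j in [set: 'I_n]) (h j @^-1` H j `&` s j @^-1` B j)) =
          (\prod_(j < n) (P (h j @^-1` H j) * P (s j @^-1` B j)))%E
      & forall w, S w =
          \matrix_(i, j) (if i == h j w then (-1) ^+ s j w else 0)].

Definition mu_bar (R : realType) (C1 C2 E eps delta : R) (r : nat) : R :=
  let p := 4 * r%:R + ln (1 / delta) in
  C1 * Num.sqrt C2 * Num.sqrt eps *
  Num.min (ln (E / (C2 * eps)) / p) (Num.sqrt (ln E / p)).

(* Main.v *)
Require Import Defs.
From mathcomp Require Import ring lra.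

Import Order.TTheory GRing.Theory Num.Theory.
Local Open Scope classical_set_scope.
Local Open Scope ring_scope.

(** Write A = U Sigma V^T.  A vector of the column space of A is U w for some
w, it has the norm of w, and the absolute values of its entries are at most the
coherence times that norm.  So S is an eps-subspace embedding as soon as the quadratic form
Q(w) = |S U w|^2 - |w|^2 satisfies |Q(w)| <= eps |w|^2.  A polarization argument
([qform_net]) shows that it suffices to have |Q| <= eps / 2 at the points of a
grid in the unit ball, of which there are at most 2^(18 r) ([net_count]).  With
p = 4 r + ln (1 / delta) and an even integer q between p and 2 p, a union bound
over the grid leaves one claim about a fixed vector x with |x| <= 1 whose
entries are at most nu in absolute value, nu being the bound on the coherence:
| |S x|^2 - |x|^2 | >= eps / 2 has probability at most 64^-q ([hashing_tail]).
This is Markov's inequality for the q-th moment, estimated as follows.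

Let xi_ij be x_j times the (i, j) entry of S.  The deviation |S x|^2 - |x|^2 is
the sum over the rows i of the products xi_ij xi_il with j <> l.

- Decoupling.  The deviation is the average, over all sets eta of columns, of
  four times the sum over i of X_i X'_i, where X_i sums the xi_ij with j in eta
  and X'_i those with j outside eta.  By convexity one may fix eta.  The gain is
  that row i contributes a product of two independent sums.  The square of the
  full sum of row i is a product too, but it contains the diagonal terms
  xi_ij^2, whose contribution to the variance, of order nu^2, may be far above
  the admissible eps^2 / p.

- Dependence between rows.  A column has its nonzero entry in one row only, so
  the rows are dependent, but in the favourable direction: a monomial in the
  xi_ij has a nonnegative expectation, and monomials that use disjoint sets of
  rows are negatively correlated, because their product vanishes when they
  share a column.  This passes to polynomials with nonnegative coefficients
  ([avg_cone_mul_le]).  Hence the exponential generating function of the moments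
  of the sum over i of X_i X'_i, truncated at degree q, is at most the product
  of those of its terms ([cone_egf_le]).  The truncation matters: the full
  exponential moment of X_i X'_i is dominated by events far too rare to affect
  the q-th moment, and is too large.

- One row.  The exponential moments of X_i and X'_i are explicit products over
  the columns, and |t|^k / k! <= e^t + e^-t - 2 for k >= 2 turns them into
  moments ([avg_row_exp_le]), with a free parameter th for each k.  For th^2
  proportional to k q / eps and u = th nu, the two terms of the minimum in the
  bound on the coherence say that e^u <= E / (C2 eps) ([th_nu_le_log]) and, by
  the inequality between arithmetic and geometric means, that e^(2u) <= e^k E
  ([two_th_nu_le]).  With the lower bound on m, this makes the k-th term of the
  generating function at most (q / m) 2^-k ([row_moment_numeric]), so that the
  product over the m rows is at most e^(q / 2).

Two facts link this to the statement.  The probability of an event that depends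
on S only is its frequency among all choices of row indices and signs
([hashing1_avg]).  The coherence is really read off a compact singular value
decomposition ([coherenceP]), whose existence is obtained by splitting off
singular vectors that maximize a quadratic form on the unit sphere.

The constants are C = C1 = 1 and C2 = 2^-19. *)

Set Implicit Arguments.
Unset Strict Implicit.
Unset Printing Implicit Defensive.

(** * Averages over finite types *)

Section Avg.
Variable R : realFieldType.

Definition avg (T : finType) (F : T -> R) : R := (\sum_t F t) / #|T|%:R.

Lemma eq_avg (T : finType) (F G : T -> R) :
  (forall t, F t = G t) -> avg F = avg G.
Proof. by move=> FG; rewrite /avg (eq_bigr G). Qed.

Lemma avgD (T : finType) (F G : T -> R) :
  avg (fun t => F t + G t) = avg F + avg G.
Proof. by rewrite /avg big_split mulrDl. Qed.

Lemma avgZ (T : finType) c (F : T -> R) : avg (fun t => c * F t) = c * avg F.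
Proof. by rewrite /avg -big_distrr mulrA. Qed.

Lemma avg_sum (T : finType) (J : Type) (r : seq J) (P : pred J) (F : J -> T -> R) :
  avg (fun t => \sum_(j <- r | P j) F j t) = \sum_(j <- r | P j) avg (F j).
Proof. by rewrite /avg exchange_big mulr_suml. Qed.

Lemma avg_exchange (T U : finType) (F : T -> U -> R) :
  avg (fun t => avg (F t)) = avg (fun u => avg (F^~ u)).
Proof.
rewrite /avg -!mulr_suml exchange_big /=.
by rewrite -!mulrA [_ ^-1 * _]mulrC.
Qed.

Lemma avg_ge0 (T : finType) (F : T -> R) : (forall t, 0 <= F t) -> 0 <= avg F.
Proof. by move=> F0; rewrite /avg divr_ge0 ?sumr_ge0. Qed.

Lemma le_avg (T : finType) (F G : T -> R) :
  (forall t, F t <= G t) -> avg F <= avg G.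
Proof. by move=> FG; rewrite /avg ler_wpM2r ?invr_ge0 ?ler_sum. Qed.

Lemma avg_cst (T : finType) (c : R) : (0 < #|T|)%N -> avg (fun _ : T => c) = c.
Proof.
move=> T0; rewrite /avg sumr_const -[c *+ _]mulr_natr.
by rewrite mulfK // pnatr_eq0 -lt0n.
Qed.

(** Independent coordinates: the uniform law on functions is a product law. *)
Lemma avg_prod (I T : finType) (phi : I -> T -> R) :
  avg (fun f : {ffun I -> T} => \prod_i phi i (f i)) = \prod_i avg (phi i).
Proof.
rewrite /avg -bigA_distr_bigA /= big_split /= card_ffun natrX.
by rewrite prodr_const exprVn.
Qed.

(** The tangent of a convex function lies below it; Jensen's inequality follows
by averaging the tangent at the mean. *)
Lemma ler_tangent_exp (a t : R) q : 0 <= a -> 0 <= t ->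
  a ^+ q + q%:R * a ^+ q.-1 * (t - a) <= t ^+ q.
Proof.
move=> a0 t0; elim: q => [|q IH]; first by rewrite !mul0r addr0.
rewrite [t ^+ _]exprS; apply: le_trans (ler_wpM2l t0 IH).
rewrite -subr_ge0 /=.
case: q {IH} => [|q] /=.
  by rewrite !expr0 expr1 !mul0r mul1r addr0; lra.
have -> : t * (a ^+ q.+1 + q.+1%:R * a ^+ q * (t - a)) -
  (a ^+ q.+2 + q.+2%:R * a ^+ q.+1 * (t - a)) =
  q.+1%:R * a ^+ q * (t - a) ^+ 2 by rewrite !exprS -[q.+2]addn1 natrD; ring.
by rewrite mulr_ge0 ?sqr_ge0 // mulr_ge0 ?exprn_ge0.
Qed.

Lemma avg_pow_le (T : finType) (F : T -> R) (q : nat) :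
  (0 < #|T|)%N -> ~~ odd q -> (avg F) ^+ q <= avg (fun t => F t ^+ q).
Proof.
move=> T0 oq.
have even_norm (z : R) : z ^+ q = `|z| ^+ q.
  by rewrite -normrX ger0_norm // exprn_even_ge0.
rewrite even_norm (eq_avg (F := fun t => F t ^+ q) (G := fun t => `|F t| ^+ q)) //.
set a := avg (fun t => `|F t|).
have a0 : 0 <= a by apply: avg_ge0.
apply: (@le_trans _ _ (a ^+ q)).
  rewrite lerXn2r ?nnegrE //.
  rewrite /a /avg normrM [`|_^-1|]ger0_norm ?invr_ge0 ?ler0n //.
  by rewrite ler_wpM2r ?invr_ge0 ?ler0n //; apply: ler_norm_sum.
have -> : a ^+ q = avg (fun t => a ^+ q + q%:R * a ^+ q.-1 * (`|F t| - a)).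
  by rewrite avgD avgZ avgD !avg_cst // subrr mulr0 addr0.
by apply: le_avg => t; apply: ler_tangent_exp.
Qed.
End Avg.

(** A Cauchy product truncated at total degree q only has terms of the product
of the two truncations. *)
Lemma sum_triangle_le (R : realFieldType) (f : nat -> nat -> R) q :
  (forall a b, 0 <= f a b) ->
  \sum_(0 <= k < q) \sum_(0 <= a < k.+1) f a (k - a)%N <=
  \sum_(0 <= a < q) \sum_(0 <= b < q) f a b.
Proof.
move=> f0.
have -> : \sum_(0 <= k < q) \sum_(0 <= a < k.+1) f a (k - a)%N =
  \sum_(0 <= k < q) \sum_(0 <= a < q | (a <= k)%N) f a (k - a)%N.
  apply: eq_big_nat => k /andP[_ kq].
  by rewrite (big_nat_widen _ _ q).
rewrite (exchange_big_dep xpredT) //=.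
apply: ler_sum_nat => a /andP[_ aq].
rewrite -(big_nat_widenl a 0 q predT) // -{1}(add0n a) big_addn.
under eq_bigr do rewrite addnK.
rewrite [leRHS](big_cat_nat _ (n := (q - a)%N)) ?leq_subr //=.
by rewrite lerDl sumr_ge0.
Qed.

(** * Polynomials with nonnegative coefficients in the signed entries *)

Section Cone.
Variables (R : realFieldType) (row col : finType) (x : col -> R).
Notation sample := {ffun col -> row * bool}.

Definition entry (i : row) (j : col) (w : row * bool) : R :=
  if w.1 == i then (-1) ^+ w.2 * x j else 0.

Definition atom (j : col) (a : option (row * nat)) (w : row * bool) : R :=
  if a is Some (i, e) then (if w.1 == i then ((-1) ^+ w.2 * x j) ^+ e else 0)
  else 1.

Definition atom_in (I : pred row) (a : option (row * nat)) :=
  if a is Some (i, _) then I i else true.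

(** In each column, a monomial carries a power of at most one entry: two entries
in different rows of the same column are never both nonzero, so that every
other monomial vanishes identically.  [None] stands for the constant 1. *)
Definition monomial (a : col -> option (row * nat)) (w : sample) : R :=
  \prod_j atom j (a j) (w j).

(** The polynomials with nonnegative coefficients in the entries of the rows
of [I].  Closure under pointwise equality saves reasoning about equality of
functions. *)
Inductive cone (I : pred row) : (sample -> R) -> Prop :=
| cone_monomial a : (forall j, atom_in I (a j)) -> cone I (monomial a)
| coneZ c F : 0 <= c -> cone I F -> cone I (fun w => c * F w)
| coneD F G : cone I F -> cone I G -> cone I (fun w => F w + G w)
| cone_ext F G : F =1 G -> cone I F -> cone I G.

(** Odd powers average to zero by the symmetry of the random sign, and even
powers are nonnegative whatever the sign of [x j]. *)
Lemma avg_atom_ge0 j a : 0 <= avg (atom j a).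
Proof.
case: a => [[i e]|] /=; last by apply: avg_ge0.
rewrite /avg divr_ge0 ?ler0n //.
rewrite -(pair_big xpredT xpredT (fun h (s : bool) =>
   if h == i then ((-1) ^+ s * x j) ^+ e else 0)) /=.
apply: sumr_ge0 => h _; rewrite big_bool /=; case: (h == i); last by rewrite addr0.
rewrite expr1 expr0 mul1r mulN1r exprNn; case: (boolP (odd e)) => oe.
  by rewrite -signr_odd oe expr1 mulN1r addNr.
by rewrite -signr_odd (negbTE oe) expr0 mul1r addr_ge0 // exprn_even_ge0.
Qed.

Definition atom_mul (a b : option (row * nat)) :=
  match a, b with
  | Some (i, e), Some (_, e') => Some (i, (e + e')%N)
  | None, _ => b
  | _, None => a
  end.

Definition atom_compat (a b : option (row * nat)) :=
  match a, b with
  | Some (i, _), Some (i', _) => i == i'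
  | _, _ => true
  end.

Lemma atom_mulE j a b w :
  atom j a w * atom j b w = (atom_compat a b)%:R * atom j (atom_mul a b) w.
Proof.
case: a b => [[i e]|] [[i' e']|] /=; rewrite ?mul1r ?mulr1 //.
have [->|ii'] := eqVneq i i'.
  by rewrite mul1r; case: ifP; rewrite ?mul0r // exprD.
rewrite mul0r; have [wi|_] := eqVneq w.1 i; last by rewrite mul0r.
by rewrite wi (negbTE ii') mulr0.
Qed.

Lemma monomial_mul a b w : monomial a w * monomial b w =
  (\prod_j (atom_compat (a j) (b j))%:R) * monomial (fun j => atom_mul (a j) (b j)) w.
Proof.
by rewrite /monomial -!big_split /=; apply: eq_bigr => j _; apply: atom_mulE.
Qed.

Lemma avg_monomial a : avg (monomial a) = \prod_j avg (atom j (a j)).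
Proof. exact: avg_prod. Qed.

Hypothesis row_gt0 : (0 < #|row|)%N.

(** Column by column: if only one of the two monomials uses the column, its
average factors out; if both do, they ask for different rows, the product
vanishes and the right-hand side is nonnegative. *)
Lemma avg_monomial_mul_le (I J : pred row) a b :
  (forall j, atom_in I (a j)) -> (forall j, atom_in J (b j)) ->
  (forall i, I i -> J i -> False) ->
  avg (fun w => monomial a w * monomial b w) <= avg (monomial a) * avg (monomial b).
Proof.
move=> aI bJ IJ.
under eq_avg do rewrite /monomial -big_split /=.
rewrite (avg_prod (fun j w => atom j (a j) w * atom j (b j) w)).
rewrite !avg_monomial -big_split /=.
have avg1 j : avg (atom j None) = 1.
  by rewrite avg_cst // card_prod card_bool muln_gt0 row_gt0.
apply: ler_prod => j _; under eq_avg do rewrite atom_mulE; rewrite avgZ.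
apply/andP; split; first by rewrite mulr_ge0 ?ler0n ?avg_atom_ge0.
have := avg_atom_ge0 j (a j); have := avg_atom_ge0 j (b j).
have := aI j; have := bJ j.
case: (a j) (b j) => [[i e]|] [[i' e']|] i'J iI A0 B0;
  rewrite ?avg1 ?mul1r ?mulr1 //=.
case: eqP => [ii'|_]; last by rewrite mul0r mulr_ge0.
by case: (IJ i); rewrite // ii'.
Qed.

Lemma avg_cone_ge0 I F : cone I F -> 0 <= avg F.
Proof.
elim=> [a _|c G c0 _ G0|G H _ G0 _ H0|G H GH _ G0].
- by rewrite avg_monomial prodr_ge0 // => j _; apply: avg_atom_ge0.
- by rewrite avgZ mulr_ge0.
- by rewrite avgD addr_ge0.
- by rewrite -(eq_avg GH).
Qed.

(** Negative correlation of disjoint sets of rows, the substitute for the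
independence that the rows do not have. *)
Lemma avg_cone_mul_le (I J : pred row) F G :
  cone I F -> cone J G -> (forall i, I i -> J i -> False) ->
  avg (fun w => F w * G w) <= avg F * avg G.
Proof.
move=> cF cG IJ.
elim: cF => [a aI|c F' c0 _ le|F1 F2 _ le1 _ le2|F1 F2 F12 _ le1].
- elim: cG => [b bJ|c G' c0 _ le|G1 G2 _ le1 _ le2|G1 G2 G12 _ le1].
  + exact: avg_monomial_mul_le aI bJ IJ.
  + under eq_avg do rewrite mulrCA.
    by rewrite !avgZ [leRHS]mulrCA ler_wpM2l.
  + under eq_avg do rewrite mulrDr.
    by rewrite !avgD mulrDr lerD.
  + by rewrite -(eq_avg G12); under eq_avg do rewrite -G12.
- under eq_avg do rewrite -mulrA.
  by rewrite !avgZ -mulrA ler_wpM2l.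
- under eq_avg do rewrite mulrDl.
  by rewrite !avgD mulrDl lerD.
- by rewrite -(eq_avg F12); under eq_avg do rewrite -F12.
Qed.

Lemma cone_sub (I J : pred row) F : (forall i, I i -> J i) ->
  cone I F -> cone J F.
Proof.
move=> IJ; elim=> [a aI|c G c0 _ G0|G H _ G0 _ H0|G H GH _ G0].
- by apply: cone_monomial => j; have := aI j; case: (a j) => [[i e]|] //= /IJ.
- exact: coneZ.
- exact: coneD.
- exact: cone_ext GH G0.
Qed.

Lemma cone1 I : cone I (fun=> 1).
Proof.
apply: (@cone_ext _ (monomial (fun=> None))); last exact: cone_monomial.
by move=> w; rewrite /monomial big1.
Qed.

Lemma cone0 I : cone I (fun=> 0).
Proof.
apply: (@cone_ext _ (fun=> 0 * 1)); first by move=> w; rewrite mul0r.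
by apply: coneZ => //; apply: cone1.
Qed.

(** Two monomials that ask for different rows in some column multiply to zero,
which is a nonnegative multiple of a monomial too. *)
Lemma coneM I F G : cone I F -> cone I G -> cone I (fun w => F w * G w).
Proof.
move=> cF cG.
elim: cF => [a aI|c F' c0 _ le|F1 F2 _ le1 _ le2|F1 F2 F12 _ le1].
- elim: cG => [b bJ|c G' c0 _ le|G1 G2 _ le1 _ le2|G1 G2 G12 _ le1].
  + apply: (cone_ext (fun w => esym (monomial_mul a b w))).
    apply: coneZ; first by apply: prodr_ge0 => j _; apply: ler0n.
    apply: cone_monomial => j; have := aI j; have := bJ j.
    by case: (a j) (b j) => [[i e]|] [[i' e']|].
  + by apply: (cone_ext (fun w => mulrCA _ _ _)); apply: coneZ.
  + by apply: (cone_ext (fun w => esym (mulrDr _ _ _))); apply: coneD.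
  + by apply: cone_ext le1 => w; rewrite G12.
- by apply: (cone_ext (fun w => mulrA _ _ _)); apply: coneZ.
- by apply: (cone_ext (fun w => esym (mulrDl _ _ _))); apply: coneD.
- by apply: cone_ext le1 => w; rewrite F12.
Qed.

Lemma coneX I F k : cone I F -> cone I (fun w => F w ^+ k).
Proof.
move=> cF; elim: k => [|k IH]; first exact: cone1.
by apply: cone_ext (coneM cF IH) => w; rewrite exprS.
Qed.

Lemma cone_sum I (K : Type) (r : seq K) (P : pred K) F :
  (forall k, P k -> cone I (F k)) ->
  cone I (fun w => \sum_(k <- r | P k) F k w).
Proof.
move=> cF; elim: r => [|k r IH].
  by apply: cone_ext (cone0 I) => w; rewrite big_nil.
case: (boolP (P k)) => Pk.
  by apply: cone_ext (coneD (cF k Pk) IH) => w; rewrite big_cons Pk.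
by apply: cone_ext IH => w; rewrite big_cons (negbTE Pk).
Qed.

Lemma cone_entry i j : cone (pred1 i) (fun w => entry i j (w j)).
Proof.
apply: (@cone_ext _ (monomial (fun j' => if j' == j then Some (i, 1%N) else None))).
  move=> w; rewrite /monomial (bigD1 j) //= eqxx big1 ?mulr1; last first.
    by move=> j' /negbTE ->.
  by rewrite /entry /=; case: ifP; rewrite ?expr1.
by apply: cone_monomial => j'; case: ifP => //=.
Qed.

Lemma exprD_fact (a b : R) k : (a + b) ^+ k / k`!%:R =
  \sum_(0 <= l < k.+1) (a ^+ l / l`!%:R) * (b ^+ (k - l)%N / (k - l)`!%:R).
Proof.
have f0 (n : nat) : n`!%:R != 0 :> R by rewrite pnatr_eq0 -lt0n fact_gt0.
rewrite addrC exprDn mulr_suml big_mkord; apply: eq_bigr => l _.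
have lk : (l <= k)%N by rewrite -ltnS.
rewrite -(bin_fact lk) -mulr_natr !natrM.
have := f0 l; have := f0 (k - l)%N; have : 'C(k, l)%:R != 0 :> R.
  by rewrite pnatr_eq0 -lt0n bin_gt0.
by move=> *; field; apply/and3P.
Qed.

(** For independent terms and without truncation this would be the
multiplicativity of exponential moments.  Nonnegativity of all moments makes
the truncation harmless and negative correlation replaces independence, both
at the cost of an inequality. *)
Lemma cone_egf_le (lam : R) q (rs : seq row) (Y : row -> sample -> R) :
  0 <= lam -> uniq rs -> (forall i, cone (pred1 i) (Y i)) ->
  \sum_(0 <= k < q) lam ^+ k / k`!%:R * avg (fun w => (\sum_(i <- rs) Y i w) ^+ k)
  <= \prod_(i <- rs) \sum_(0 <= k < q) lam ^+ k / k`!%:R * avg (fun w => Y i w ^+ k).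
Proof.
move=> lam0 + cY; elim: rs => [_|i rs IH /= /andP[irs /IH {}IH]].
  rewrite big_nil; case: q => [|q]; first by rewrite big_nil.
  rewrite big_nat_recl // big1 ?addr0.
    rewrite expr0 fact0 divr1 mul1r; under eq_avg do rewrite expr0.
    rewrite /avg sumr_const -mulr_natl mulr1; case: (posnP #|{: sample}|) => [->|s0].
      by rewrite mul0r.
    by rewrite divff // pnatr_eq0 -lt0n.
  move=> k _; rewrite (eq_avg (G := fun=> 0 * 1)); last first.
    by move=> w; rewrite big_nil expr0n mul0r.
  by rewrite avgZ mul0r mulr0.
rewrite big_cons; set Z := fun w => \sum_(i <- rs) Y i w.
have cZ : cone (mem rs) Z.
  rewrite /Z.
  apply: (@cone_ext _ (fun w => \sum_(i <- rs | i \in rs) Y i w)).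
    by move=> w; rewrite -big_seq.
  by apply: cone_sum => i' i'r; apply: cone_sub (cY i') => i'' /eqP ->.
pose f a b := (lam ^+ a / a`!%:R * avg (fun w => Y i w ^+ a)) *
  (lam ^+ b / b`!%:R * avg (fun w => Z w ^+ b)).
have term_ge0 I F k : cone I F ->
    0 <= lam ^+ k / k`!%:R * avg (fun w => F w ^+ k).
  move=> cF; apply: mulr_ge0; last exact: avg_cone_ge0 (coneX _ cF).
  by rewrite divr_ge0 ?ler0n ?exprn_ge0.
have f0 a b : 0 <= f a b.
  exact: mulr_ge0 (term_ge0 _ _ _ (cY i)) (term_ge0 _ _ _ cZ).
apply: (@le_trans _ _ (\sum_(0 <= a < q) \sum_(0 <= b < q) f a b)); last first.
  rewrite [leLHS](eq_bigr (fun a => lam ^+ a / a`!%:R * avg (fun w => Y i w ^+ a) *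
    \sum_(0 <= b < q) lam ^+ b / b`!%:R * avg (fun w => Z w ^+ b))); last first.
    by move=> a _; rewrite mulr_sumr.
  rewrite -mulr_suml ler_wpM2l //; apply: sumr_ge0 => k _.
  exact: term_ge0 (cY i).
apply: le_trans (sum_triangle_le q f0).
apply: ler_sum_nat => k _.
have -> : lam ^+ k / k`!%:R * avg (fun w => (\sum_(i0 <- (i :: rs)) Y i0 w) ^+ k) =
  \sum_(0 <= a < k.+1) (lam ^+ a / a`!%:R) * (lam ^+ (k - a) / (k - a)`!%:R) *
     avg (fun w => Y i w ^+ a * Z w ^+ (k - a)).
  rewrite -mulrA -avgZ.
  rewrite (eq_avg (G := fun w => \sum_(0 <= a < k.+1)
     (a`!%:R^-1 * (k - a)`!%:R^-1) * (Y i w ^+ a * Z w ^+ (k - a)))); last first.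
    move=> w; rewrite big_cons mulrC exprD_fact; apply: eq_bigr => a _.
    by rewrite /Z; ring.
  rewrite avg_sum mulr_sumr; apply: eq_big_nat => a /andP[_ ak].
  by rewrite avgZ -{1}(subnKC (n := k) (m := a)) // exprD; ring.
apply: ler_sum_nat => a _.
rewrite /f [leRHS]mulrACA ler_wpM2l //.
  by rewrite !mulr_ge0 ?invr_ge0 ?ler0n ?exprn_ge0.
apply: avg_cone_mul_le (coneX _ (cY i)) (coneX _ cZ) _.
by move=> i' /eqP ->; apply/negP.
Qed.
End Cone.

(** * Exponential moments of one row *)

Section Exponential.
Variable R : realType.

Lemma expR_ge1DxDxn (x : R) k : 0 <= x -> (1 < k)%N ->
  1 + x + x ^+ k / k`!%:R <= expR x.
Proof.
move=> x0 k1; apply: (@le_trans _ _ (series (exp_coeff x) k.+1)).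
  rewrite /series /= big_nat_recr // lerD2r.
  case: k k1 => [|[|k]] // _.
  rewrite big_nat_recl // big_nat_recl //= addrA /exp_coeff /=.
  rewrite expr0 fact0 divr1 expr1 divr1 lerDl sumr_ge0 // => i _.
  by rewrite divr_ge0 // exprn_ge0.
apply: nondecreasing_cvgn_le; last exact: is_cvg_series_exp_coeff.
apply/nondecreasing_seqP => n; rewrite /series /= big_nat_recr //= lerDl.
exact: exp_coeff_ge0.
Qed.

(** 2 cosh z - 2, which controls all the powers from the second on while its
average under a random sign remains computable. *)
Definition cosh2 (z : R) : R := expR z + expR (- z) - 2.

Lemma cosh2N z : cosh2 (- z) = cosh2 z.
Proof. by rewrite /cosh2 opprK [expR _ + _]addrC. Qed.

Lemma cosh2_abs z : cosh2 `|z| = cosh2 z.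
Proof. by case: (ger0P z) => // _; rewrite cosh2N. Qed.

(** For t = |z|, the bound e^-t >= 1 - t gives cosh2 z >= e^t - 1 - t, whose
series contains every power from the second on, odd ones included. *)
Lemma cosh2_ge_exp z k : (1 < k)%N -> `|z| ^+ k / k`!%:R <= cosh2 z.
Proof.
move=> k1; rewrite -cosh2_abs /cosh2.
have := expR_ge1DxDxn (normr_ge0 z) k1.
have := expR_ge1Dx (- `|z|); lra.
Qed.

Lemma cosh2_ge0 z : 0 <= cosh2 z.
Proof.
apply: le_trans (cosh2_ge_exp z (isT : (1 < 2)%N)).
by rewrite divr_ge0 // exprn_ge0.
Qed.

Lemma expR_sub1_le (z : R) : expR z - 1 <= z * expR z.
Proof.
have : (1 - z) * expR z <= 1.
  rewrite -[leRHS](expRxMexpNx_1 z) mulrC ler_wpM2l ?expR_ge0 //.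
  exact: expR_ge1Dx.
by rewrite mulrBl mul1r; lra.
Qed.

(** e^t + e^-t - 2 is (e^t - 1)^2 e^-t, and e^t - 1 <= t e^t. *)
Lemma cosh2_le z u : `|z| <= u -> cosh2 z <= z ^+ 2 * expR u.
Proof.
move=> zu; rewrite -cosh2_abs -[z ^+ 2]real_normK ?num_real //.
set t := `|z|; have t0 : 0 <= t := normr_ge0 z.
apply: (@le_trans _ _ (t ^+ 2 * expR t)); last first.
  by rewrite ler_wpM2l ?sqr_ge0 // ler_expR.
have -> : cosh2 t = (expR t - 1) ^+ 2 * expR (- t).
  have e := expRxMexpNx_1 t; rewrite /cosh2.
  have -> : (expR t - 1) ^+ 2 * expR (- t) =
    expR t * (expR t * expR (- t)) - 2 * (expR t * expR (- t)) + expR (- t) by ring.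
  by rewrite e; ring.
have -> : t ^+ 2 * expR t = (t * expR t) ^+ 2 * expR (- t).
  have e := expRxMexpNx_1 t.
  have -> : (t * expR t) ^+ 2 * expR (- t) =
    t ^+ 2 * expR t * (expR t * expR (- t)) by ring.
  by rewrite e mulr1.
rewrite ler_wpM2r ?expR_ge0 // lerXn2r ?nnegrE ?expR_sub1_le //.
  by rewrite subr_ge0 -expR0 ler_expR.
by rewrite mulr_ge0 ?expR_ge0.
Qed.
End Exponential.

Section OneRow.
Variables (R : realType) (row col : finType) (x : col -> R).
Hypothesis row_gt0 : (0 < #|row|)%N.
Notation sample := {ffun col -> row * bool}.
Notation m := (#|row|%:R : R).

Let m_gt0 : 0 < m. Proof. by rewrite ltr0n. Qed.

Lemma avg_row_bool (f : row -> bool -> R) :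
  avg (fun w : row * bool => f w.1 w.2) =
  (\sum_(h : row) (f h true + f h false)) / (m * 2).
Proof.
rewrite /avg card_prod card_bool natrM; congr (_ / _).
rewrite -(pair_big xpredT xpredT f) /=.
by apply: eq_bigr => h _; rewrite big_bool.
Qed.

Lemma avg_expR_entry (i : row) j t :
  avg (fun w => expR (t * entry x i j w)) = 1 + cosh2 (t * x j) / (m * 2).
Proof.
rewrite /entry (avg_row_bool (fun h s =>
   expR (t * if h == i then (-1) ^+ s * x j else 0))).
rewrite (bigD1 i) //= eqxx expr1 expr0 mul1r mulN1r mulrN.
rewrite (eq_bigr (fun=> 2)); last first.
  by move=> h /negbTE ->; rewrite mulr0 expR0.
rewrite sumr_const cardC1 -[2 *+ _]mulr_natl.
have -> : #|row|.-1%:R = m - 1 by rewrite -{2}(prednK row_gt0) -natr1 addrK.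
by rewrite /cosh2; field; rewrite gt_eqF.
Qed.

Lemma avg_entry (i : row) j : avg (entry x i j) = 0.
Proof.
rewrite /entry (avg_row_bool (fun h s =>
   if h == i then (-1) ^+ s * x j else 0)).
rewrite big1 ?mul0r // => h _; case: ifP => _; last by rewrite addr0.
by rewrite expr1 expr0 mul1r mulN1r addNr.
Qed.

Lemma avg_entry_mul (i : row) j l : j != l ->
  avg (fun w : sample => entry x i j (w j) * entry x i l (w l)) = 0.
Proof.
move=> jl.
pose phi k p := (if k == j then entry x i j p else 1) *
  (if k == l then entry x i l p else 1).
rewrite (eq_avg (G := fun w : sample => \prod_k phi k (w k))).
  rewrite avg_prod (bigD1 j) //= {1}/phi eqxx (negbTE jl).
  by under eq_avg do rewrite mulr1; rewrite avg_entry mul0r.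
move=> w; rewrite big_split /= -big_mkcond /= -big_mkcond /=.
by rewrite !big_pred1_eq.
Qed.

Definition part (eta : {ffun col -> bool}) (i : row) (w : sample) : R :=
  \sum_(j | eta j) entry x i j (w j).
Definition copart (eta : {ffun col -> bool}) (i : row) (w : sample) : R :=
  \sum_(j | ~~ eta j) entry x i j (w j).

(** The generating function of the moments of one row has no linear term; this
leaves the degrees k >= 2, to which [cosh2] applies. *)
Lemma avg_part_copart eta i :
  avg (fun w => part eta i w * copart eta i w) = 0.
Proof.
under eq_avg do rewrite /part /copart mulr_suml.
rewrite avg_sum big1 // => j ej.
under eq_avg do rewrite mulr_sumr.
rewrite avg_sum big1 // => l el.
by apply: avg_entry_mul; apply: contraNneq el => <-.
Qed.

(** The columns are independent, so the joint exponential moment of the two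
halves of a row is a product over the columns. *)
Lemma avg_expR_parts eta i (a b : R) :
  avg (fun w => expR (a * part eta i w + b * copart eta i w)) =
  \prod_(j | eta j) (1 + cosh2 (a * x j) / (m * 2)) *
  \prod_(j | ~~ eta j) (1 + cosh2 (b * x j) / (m * 2)).
Proof.
pose phi j p := expR ((if eta j then a else b) * entry x i j p).
rewrite (eq_avg (G := fun w : sample => \prod_j phi j (w j))).
  rewrite avg_prod (bigID eta) /= /phi; congr (_ * _); apply: eq_bigr => j.
    by move=> ->; rewrite avg_expR_entry.
  by move=> /negbTE ->; rewrite avg_expR_entry.
move=> w; rewrite -expR_sum; congr expR.
rewrite (bigID eta) /= /part /copart !mulr_sumr; congr (_ + _).
  by apply: eq_bigr => j ->.
by apply: eq_bigr => j /negbTE ->.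
Qed.

Section Moment.
Variables (th u : R).
Hypotheses (x_norm : \sum_j x j ^+ 2 <= 1) (x_u : forall j, `|th * x j| <= u).
Let y := th ^+ 2 * expR u / (m * 2).

Let y_ge0 : 0 <= y.
Proof. by rewrite /y divr_ge0 // mulr_ge0 ?sqr_ge0 ?expR_ge0 ?ler0n. Qed.

Lemma prod_cosh2_bounds (P : pred col) :
  0 <= \prod_(j | P j) (1 + cosh2 (th * x j) / (m * 2)) - 1 <= y * expR y.
Proof.
have c0 j : 0 <= cosh2 (th * x j) / (m * 2).
  by rewrite divr_ge0 ?cosh2_ge0 ?mulr_ge0 ?ler0n.
apply/andP; split.
  rewrite subr_ge0; apply: (big_ind (fun z => 1 <= z)) => //.
    by move=> a b a1 b1; rewrite -[1]mulr1 ler_pM.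
  by move=> j _; rewrite lerDl.
apply: le_trans (expR_sub1_le y); rewrite lerD2r.
apply: (@le_trans _ _ (expR (\sum_(j | P j) cosh2 (th * x j) / (m * 2)))).
  rewrite expR_sum; apply: ler_prod => j _.
  by rewrite addr_ge0 //= expR_ge1Dx.
rewrite ler_expR /y -mulr_suml ler_wpM2r ?invr_ge0 ?mulr_ge0 ?ler0n //.
apply: (@le_trans _ _ (\sum_j th ^+ 2 * expR u * x j ^+ 2)).
  rewrite [leRHS](bigID P) /= -[leLHS]addr0 lerD //.
    apply: ler_sum => j _; apply: le_trans (cosh2_le (x_u j)) _.
    by rewrite exprMn mulrAC.
  apply: sumr_ge0 => j _.
  by rewrite -mulrA mulr_ge0 ?sqr_ge0 // mulr_ge0 ?sqr_ge0 ?expR_ge0.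
by rewrite -mulr_sumr ler_piMr // mulr_ge0 ?sqr_ge0 ?expR_ge0.
Qed.

(** Both halves of the row are bounded through [cosh2].  Expanding the product
of the two brackets and using that [cosh2] is even leaves (A - 1)(B - 1) with
the two products A and B over the columns of either half; each factor is of
order 1 / m, and this second power of 1 / m is what lets the sum over m rows
stay small. *)
Lemma avg_row_exp_le eta i k : (1 < k)%N -> 0 < th ->
  avg (fun w => (part eta i w * copart eta i w) ^+ k) <=
  (k`!%:R / th ^+ k) ^+ 2 * (4 * (y * expR y) ^+ 2).
Proof.
move=> k1 th0; set c := (k`!%:R / th ^+ k).
have c0 : 0 <= c by rewrite divr_ge0 // exprn_ge0 // ltW.
have bound (z : R) : `|z| ^+ k <= c * cosh2 (th * z).
  have := cosh2_ge_exp (th * z) k1.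
  rewrite normrM exprMn (gtr0_norm th0) => le.
  have -> : `|z| ^+ k = c * (th ^+ k * `|z| ^+ k / k`!%:R).
    have : th ^+ k != 0 by rewrite gt_eqF ?exprn_gt0.
    have : k`!%:R != 0 :> R by rewrite pnatr_eq0 -lt0n fact_gt0.
    rewrite /c; move: (th ^+ k) (k`!%:R) => T f f0 T0.
    by field; apply/andP.
  by rewrite ler_wpM2l.
apply: (@le_trans _ _ (avg (fun w => c ^+ 2 *
   (cosh2 (th * part eta i w) * cosh2 (th * copart eta i w))))).
  apply: le_avg => w; apply: le_trans (ler_norm _) _.
  rewrite normrX normrM exprMn expr2 mulrACA ler_pM ?exprn_ge0 //.
rewrite avgZ ler_wpM2l ?sqr_ge0 //.
pose A P := \prod_(j | P j) (1 + cosh2 (th * x j) / (m * 2)) : R.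
have expand : avg (fun w =>
    cosh2 (th * part eta i w) * cosh2 (th * copart eta i w)) =
  4 * ((A eta - 1) * (A (fun j => ~~ eta j) - 1)).
  pose e a b w := expR (a * part eta i w + b * copart eta i w).
  have A0 (P : pred col) : \prod_(j | P j) (1 + cosh2 (0 * x j) / (m * 2)) = 1 :> R.
    rewrite big1 // => j _; rewrite mul0r /cosh2 oppr0 expR0.
    by rewrite (_ : 1 + 1 - 2 = 0) ?mul0r ?addr0 //; ring.
  have AN (P : pred col) : \prod_(j | P j) (1 + cosh2 (- th * x j) / (m * 2)) = A P.
    by apply: eq_bigr => j _; rewrite mulNr cosh2N.
  have eE a b : avg (e a b) = _ := avg_expR_parts eta i a b.
  (* The nine terms of the product of (e^a + e^-a - 2) and (e^b + e^-b - 2). *)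
  rewrite (eq_avg (G := fun w =>
      (e th th w + e th (- th) w + (e (- th) th w + e (- th) (- th) w))
      + (-2) * (e th 0 w + e (- th) 0 w + (e 0 th w + e 0 (- th) w))
      + 4 * e 0 0 w)); last first.
    by move=> w; rewrite /cosh2 /e !expRD !mul0r !expR0 !mulNr; ring.
  by rewrite !(avgD, avgZ) !eE !A0 !AN -!/(A _); ring.
rewrite expand ler_wpM2l // expr2.
have /andP[a0 a1] := prod_cosh2_bounds eta.
have /andP[b0 b1] := prod_cosh2_bounds (fun j => ~~ eta j).
by rewrite ler_pM.
Qed.
End Moment.
End OneRow.

(** * Weighing the moments of one row *)

Section Numeric.
Variable R : realType.

Lemma expR_half_le2 : expR (2^-1) <= 2 :> R.
Proof.
have := expRxMexpNx_1 (2^-1 : R); have := expR_ge1Dx (- 2^-1 : R).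
have := expR_gt0 (2^-1 : R).
set a := expR 2^-1; set b := expR _ => a0 b2 ab.
have : a * 2^-1 <= a * b by rewrite ler_pM2l //; lra.
lra.
Qed.

Lemma expR1_le4 : expR 1 <= 4 :> R.
Proof.
rewrite [X in expR X](_ : 1 = 2^-1 + 2^-1); last by field.
rewrite expRD (_ : 4 = 2 * 2 :> R); last by ring.
by rewrite ler_pM ?expR_ge0 ?expR_half_le2.
Qed.

Lemma fact_le_expn k : (k`! <= k ^ k)%N.
Proof.
elim: k => // k IH; rewrite factS expnS leq_mul2l /=.
by apply: leq_trans IH _; case: k => // k; rewrite leq_exp2r.
Qed.

Lemma sqr_le_exp4 k : (k ^ 2 <= 4 ^ k)%N.
Proof.
rewrite (_ : 4 = 2 ^ 2)%N // -expnM mulnC expnM.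
by rewrite leq_exp2r // ltnW // ltn_expl.
Qed.

(** With th^2 = 2^7 lam k the factorials are absorbed by k! <= k^k, which leaves
2^(-7 k).  The value 2^-19 = 1 / (4 * 2^7 * 2^10) of C2 gives y <= k / 2, hence
e^(2 y) <= e^k, and makes the remaining factor at most (q / m) k^2 e^k / 8.
The exponentials and k^2 together cost at most 4^(3 k) = 2^(6 k), and 2^-k is
left over. *)
Lemma row_moment_numeric (eps E m th u : R) (q k : nat) :
  let C2 := (2 ^+ 19)^-1 in let lam := 2 ^+ 10 * q%:R / eps in
  let y := th ^+ 2 * expR u / (m * 2) in
  0 < eps -> 0 < m -> (0 < q)%N -> (1 < k)%N -> 0 < E ->
  th ^+ 2 = 2 ^+ 7 * lam * k%:R ->
  expR u <= E / (C2 * eps) -> expR u ^+ 2 <= expR k%:R * E ->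
  E * C2 ^- 2 * eps ^- 2 * q%:R <= 2 * m ->
  lam ^+ k / k`!%:R * ((k`!%:R / th ^+ k) ^+ 2 * (4 * (y * expR y) ^+ 2)) <=
  q%:R / m * 2^-1 ^+ k.
Proof.
move=> C2 lam y e0 m0 q0 k1 E0 thE uE u2E mE.
have q0' : 0 < q%:R :> R by rewrite ltr0n.
have k0' : 0 < k%:R :> R by rewrite ltr0n ltnW.
have lam0 : 0 < lam by rewrite divr_gt0 // mulr_gt0 // exprn_gt0.
have f0 : 0 < k`!%:R :> R by rewrite ltr0n fact_gt0.
have pre : lam ^+ k / k`!%:R * (k`!%:R / th ^+ k) ^+ 2 <= (2 ^+ 7)^-1 ^+ k.
  have -> : lam ^+ k / k`!%:R * (k`!%:R / th ^+ k) ^+ 2 =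
      k`!%:R * lam ^+ k / (th ^+ 2) ^+ k.
    have -> : (th ^+ 2) ^+ k = (th ^+ k) ^+ 2 by rewrite -!exprM mulnC.
    have : th ^+ k != 0.
      rewrite expf_eq0; apply/nandP; right; rewrite -sqrf_eq0 thE.
      by rewrite gt_eqF // mulr_gt0 // mulr_gt0 // ltr0n.
    move: (th ^+ k) (lam ^+ k) => T A T0.
    by field; rewrite T0 gt_eqF.
  rewrite thE; move: (lam) lam0 => l l0.
  rewrite [(2 ^+ 7 * l * _) ^+ k]exprMn [(2 ^+ 7 * l) ^+ k]exprMn exprVn.
  have -> : k`!%:R * l ^+ k / ((2 ^+ 7) ^+ k * l ^+ k * k%:R ^+ k) =
     ((2 ^+ 7) ^+ k)^-1 * (k`!%:R / k%:R ^+ k) :> R.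
    have : l ^+ k != 0 by rewrite gt_eqF ?exprn_gt0.
    have : k%:R ^+ k != 0 :> R by rewrite gt_eqF ?exprn_gt0.
    have : (2 ^+ 7) ^+ k != 0 :> R by rewrite gt_eqF ?exprn_gt0.
    move: (l ^+ k) (k%:R ^+ k : R) ((2 ^+ 7) ^+ k : R) => a b c c0 b0 a0.
    by field; rewrite a0 b0 c0.
  rewrite ler_piMr ?invr_ge0 ?exprn_ge0 // ler_pdivrMr ?exprn_gt0 // mul1r.
  by rewrite -natrX ler_nat fact_le_expn.
have y0 : 0 <= y.
  by rewrite /y divr_ge0 // mulr_ge0 ?sqr_ge0 ?expR_ge0 // ltW.
have yk : 2 * y <= k%:R.
  have -> : 2 * y = k%:R * (2 ^+ 7 * 2 ^+ 10 * q%:R / (m * eps) * expR u).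
    by rewrite /y thE /lam; field; rewrite !gt_eqF.
  rewrite ler_piMr ?(ltW k0') //.
  have h0 : 0 <= 2 ^+ 7 * 2 ^+ 10 * q%:R / (m * eps) by rewrite divr_ge0 ?mulr_ge0 // ltW.
  apply: le_trans (ler_wpM2l h0 uE) _.
  have -> : 2 ^+ 7 * 2 ^+ 10 * q%:R / (m * eps) * (E / (C2 * eps)) =
    (E * C2 ^- 2 * eps ^- 2 * q%:R) * ((4 * m)^-1).
    by rewrite /C2; field; rewrite !gt_eqF.
  by rewrite ler_pdivrMr ?mulr_gt0 // mul1r; lra.
(* One of the two powers of 1 / m in y^2 is estimated by the lower bound on m. *)
have y2 : 4 * y ^+ 2 <= q%:R / m * (8^-1 * k%:R ^+ 2 * expR k%:R).
  have -> : 4 * y ^+ 2 =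
     k%:R ^+ 2 * ((2 ^+ 7 * 2 ^+ 10 * q%:R / (m * eps)) ^+ 2 * expR u ^+ 2).
    by rewrite /y thE /lam; field; rewrite !gt_eqF.
  have h0 := sqr_ge0 (2 ^+ 7 * 2 ^+ 10 * q%:R / (m * eps)).
  apply: le_trans (ler_wpM2l (sqr_ge0 _) (ler_wpM2l h0 u2E)) _.
  have -> : k%:R ^+ 2 * ((2 ^+ 7 * 2 ^+ 10 * q%:R / (m * eps)) ^+ 2 * (expR k%:R * E)) =
    (k%:R ^+ 2 * expR k%:R * q%:R / m ^+ 2 / 16) * (E * C2 ^- 2 * eps ^- 2 * q%:R).
    by rewrite /C2; field; rewrite !gt_eqF.
  have h1 : 0 <= k%:R ^+ 2 * expR k%:R * q%:R / m ^+ 2 / 16 :> R.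
    by rewrite !divr_ge0 ?ler0n ?(exprn_ge0 2 (ltW m0)) // mulr_ge0 ?ler0n //
      mulr_ge0 ?sqr_ge0 ?expR_ge0.
  apply: le_trans (ler_wpM2l h1 mE) _.
  by rewrite le_eqVlt; apply/orP; left; apply/eqP; field; rewrite gt_eqF.
have ek : expR (k%:R : R) <= 4 ^+ k.
  rewrite -[k%:R]mulr1 expRM_natl lerXn2r ?nnegrE ?expR_ge0 //.
  exact: expR1_le4.
apply: (@le_trans _ _ ((2 ^+ 7)^-1 ^+ k *
    (q%:R / m * (8^-1 * 4 ^+ k * 4 ^+ k) * 4 ^+ k))).
  rewrite mulrA; apply: ler_pM => //.
  - by rewrite mulr_ge0 ?sqr_ge0 // divr_ge0 // exprn_ge0 // ltW.
  - by rewrite mulr_ge0 ?sqr_ge0.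
  rewrite exprMn [4 * _]mulrA; apply: ler_pM; rewrite ?sqr_ge0 //.
  - by rewrite mulr_ge0 ?sqr_ge0.
  - apply: le_trans y2 _; rewrite ler_wpM2l ?divr_ge0 ?ler0n ?(ltW m0) //.
    apply: ler_pM; rewrite ?expR_ge0 //.
    by rewrite ler_wpM2l ?invr_ge0 // -!natrX ler_nat sqr_le_exp4.
  - apply: le_trans ek; rewrite -expRM_natl ler_expR.
    by apply: le_trans yk; rewrite mulr_natl.
have -> : (2 ^+ 7)^-1 ^+ k * (q%:R / m * (8^-1 * 4 ^+ k * 4 ^+ k) * 4 ^+ k) =
   8^-1 * (q%:R / m * (((2 ^+ 7)^-1 * 4 * 4 * 4) ^+ k)).
  by rewrite !exprMn; ring.
have -> : ((2 ^+ 7)^-1 * 4 * 4 * 4 : R) = 2^-1 by field.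
rewrite ler_piMl //; last by lra.
by rewrite mulr_ge0 ?exprn_ge0 ?invr_ge0 // divr_ge0 // ltW.
Qed.
End Numeric.

(** * Decoupling *)

Section Decoupling.
Variables (R : realType) (row col : finType) (x : col -> R).
Hypothesis row_gt0 : (0 < #|row|)%N.
Notation sample := {ffun col -> row * bool}.

Definition deviation (w : sample) : R :=
  \sum_i (\sum_j entry x i j (w j)) ^+ 2 - \sum_j x j ^+ 2.

Definition decoupled (eta : {ffun col -> bool}) (w : sample) : R :=
  \sum_i part x eta i w * copart x eta i w.

(** Two distinct columns are separated in a given order by a quarter of the
subsets; this is the factor 4 in the decoupling identity. *)
Lemma avg_separated (j l : col) :
  avg (fun eta : {ffun col -> bool} => (eta j && ~~ eta l)%:R) =
  (j != l)%:R / 4 :> R.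
Proof.
have [->|jl] := eqVneq j l.
  rewrite /= mulr0n mul0r (eq_avg (G := fun=> 0 * 1)) ?avgZ ?mul0r // => eta.
  by rewrite andbN.
pose phi k (b : bool) : R := (if k == j then b%:R else 1) *
  (if k == l then (~~ b)%:R else 1).
rewrite (eq_avg (G := fun eta : {ffun col -> bool} => \prod_k phi k (eta k))).
  rewrite avg_prod (bigD1 j) //= (bigD1 l) 1?eq_sym //= big1 => [|k /andP[kj kl]].
    rewrite /phi /avg !big_bool /= !eqxx (eq_sym l j) (negbTE jl) card_bool /=.
    by field.
  by rewrite /phi (negbTE kj) (negbTE kl) mulr1 avg_cst // card_bool.
move=> eta; rewrite big_split /= -big_mkcond /= -big_mkcond /= !big_pred1_eq.
by rewrite -natrM mulnb.
Qed.

(** Each column has exactly one nonzero entry, so the diagonal terms of |S x|^2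
add up to |x|^2 whatever the sample. *)
Lemma sum_entry_sqr (w : sample) :
  \sum_i \sum_j entry x i j (w j) ^+ 2 = \sum_j x j ^+ 2.
Proof.
rewrite exchange_big /=; apply: eq_bigr => j _.
rewrite (bigD1 (w j).1) //= big1 ?addr0 /entry.
  by rewrite eqxx exprMn sqrr_sign mul1r.
by move=> i /negbTE; rewrite eq_sym => ->; rewrite expr0n.
Qed.

(** Off the diagonal the average over [eta] keeps a quarter of each product, and
on the diagonal it gives zero. *)
Lemma deviation_decouple (w : sample) :
  deviation w = avg (fun eta => 4 * decoupled eta w).
Proof.
rewrite /deviation -(sum_entry_sqr w) -sumrB avgZ avg_sum mulr_sumr.
apply: eq_bigr => i _; set xi := fun j => entry x i j (w j).
rewrite (eq_avg (G := fun eta : {ffun col -> bool} => \sum_j \sum_l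
    xi j * xi l * (eta j && ~~ eta l)%:R)); last first.
  move=> eta; rewrite /part /copart big_mkcond mulr_suml; apply: eq_bigr => j _.
  rewrite big_mkcond mulr_sumr; apply: eq_bigr => l _.
  by rewrite /xi; case: (eta j); case: (eta l); rewrite ?mulr1 ?mulr0 ?mul0r.
rewrite avg_sum mulr_sumr expr2 mulr_suml -sumrB; apply: eq_bigr => j _.
rewrite avg_sum mulr_sumr mulr_sumr (bigD1 j) //= [in RHS](bigD1 j) //=.
rewrite avgZ avg_separated eqxx mul0r mulr0 mulr0 add0r -expr2 {1}/xi.
rewrite [_ + \sum_(_ | _) _]addrC addrK; apply: eq_bigr => l lj.
by rewrite avgZ avg_separated eq_sym lj /xi /=; field.
Qed.

Lemma avg_deviation_exp_le q B : ~~ odd q ->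
  (forall eta, avg (fun w => decoupled eta w ^+ q) <= B) ->
  avg (fun w => deviation w ^+ q) <= 4 ^+ q * B.
Proof.
move=> oq le.
have eta0 : (0 < #|{: {ffun col -> bool}}|)%N.
  by rewrite card_ffun card_bool expn_gt0.
apply: (@le_trans _ _ (avg (fun w : sample => avg (fun eta =>
   4 ^+ q * decoupled eta w ^+ q)))).
  apply: le_avg => w; rewrite deviation_decouple.
  apply: le_trans (avg_pow_le _ eta0 oq) _.
  by apply: le_avg => eta; rewrite exprMn.
rewrite avg_exchange -[leRHS](avg_cst _ eta0).
by apply: le_avg => eta; rewrite avgZ ler_wpM2l // exprn_ge0.
Qed.

Lemma cone_part_copart eta (i : row) :
  cone x (pred1 i) (fun w => part x eta i w * copart x eta i w).
Proof. by apply: coneM; apply: cone_sum => j _; apply: cone_entry. Qed.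

Lemma cone_decoupled eta : cone x predT (decoupled eta).
Proof.
by apply: cone_sum => i _; apply: cone_sub (cone_part_copart eta i).
Qed.

Lemma sum_half_pow n : \sum_(0 <= k < n) (2^-1 : R) ^+ k.+2 <= 2^-1.
Proof.
have -> : \sum_(0 <= k < n) (2^-1 : R) ^+ k.+2 = 2^-1 - 2^-1 ^+ n.+1.
  elim: n => [|n IH]; first by rewrite big_nil expr1 subrr.
  by rewrite big_nat_recr //= IH !exprS; field.
by rewrite gerBl exprn_ge0 ?invr_ge0.
Qed.

(** Only the term of degree q of the truncated generating function is kept on
the left.  On the right, each row contributes 1 + 0 + a geometric series, hence
at most e^(q / (2 m)). *)
Lemma avg_decoupled_exp_le eta (lam : R) q :
  0 < lam -> (1 < q)%N ->
  (forall (i : row) k, (1 < k <= q)%N -> lam ^+ k / k`!%:R *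
     avg (fun w => (part x eta i w * copart x eta i w) ^+ k) <=
     q%:R / #|row|%:R * 2^-1 ^+ k) ->
  avg (fun w => decoupled eta w ^+ q) <= q`!%:R / lam ^+ q * expR (q%:R / 2).
Proof.
move=> lam0 q1 le.
have f0 : 0 < q`!%:R :> R by rewrite ltr0n fact_gt0.
have m0 : 0 < #|row|%:R :> R by rewrite ltr0n.
suff : lam ^+ q / q`!%:R * avg (fun w => decoupled eta w ^+ q) <= expR (q%:R / 2).
  move=> h; rewrite mulrC -ler_pdivrMr ?divr_gt0 ?exprn_gt0 // invf_div.
  by rewrite mulrC.
apply: (@le_trans _ _ (\sum_(0 <= k < q.+1) lam ^+ k / k`!%:R *
   avg (fun w => decoupled eta w ^+ k))).
  rewrite big_nat_recr //= lerDr; apply: sumr_ge0 => k _.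
  apply: mulr_ge0; first by rewrite divr_ge0 ?exprn_ge0 // ltW.
  exact: avg_cone_ge0 (coneX _ (cone_decoupled eta)).
apply: le_trans (cone_egf_le row_gt0 q.+1 (ltW lam0) (index_enum_uniq row)
  (cone_part_copart eta)) _.
apply: (@le_trans _ _ (\prod_(i : row) expR (q%:R / 2 / #|row|%:R))); last first.
  rewrite prodr_const -expRM_natl ler_expR.
  by rewrite mulrC divfK // gt_eqF.
apply: ler_prod => i _; apply/andP; split.
  apply: sumr_ge0 => k _; apply: mulr_ge0.
    by rewrite divr_ge0 ?exprn_ge0 // ltW.
  exact: avg_cone_ge0 (coneX _ (cone_part_copart eta i)).
apply: le_trans (expR_ge1Dx _).
case: q q1 le {f0} => // q q1 le.
rewrite big_nat_recl // big_nat_recl //= expr0 fact0 divr1 mul1r.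
under eq_avg do rewrite expr0.
rewrite avg_cst ?card_ffun ?card_prod ?card_bool ?expn_gt0 ?muln_gt0 ?row_gt0 //.
rewrite lerD2l; under eq_avg do rewrite expr1.
rewrite avg_part_copart // mulr0 add0r.
apply: (@le_trans _ _ (q.+1%:R / #|row|%:R * \sum_(0 <= k < q) 2^-1 ^+ k.+2)).
  rewrite mulr_sumr; apply: ler_sum_nat => k /andP[_ kq].
  by apply: le; rewrite ltnS.
apply: le_trans (ler_wpM2l _ (sum_half_pow q)) _; first by rewrite divr_ge0 // ltW.
by rewrite mulrAC.
Qed.
End Decoupling.

(** * The tail bound for one vector *)

Section Tail.
Variables (R : realType) (row col : finType) (x : col -> R).
Hypothesis row_gt0 : (0 < #|row|)%N.
Notation sample := {ffun col -> row * bool}.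
Notation m := (#|row|%:R : R).

Variables (eps E p nu : R) (q : nat).
Let C2 : R := (2 ^+ 19)^-1.
Hypotheses (eps_gt0 : 0 < eps) (eps_lt1 : eps < 1) (E_ge1 : 1 <= E).
Hypotheses (q_gt1 : (1 < q)%N) (q_even : ~~ odd q).
Hypothesis qp : q%:R <= 2 * p.
Hypothesis m_large : E * C2 ^- 2 * eps ^- 2 * p <= m.
Hypothesis nu_small : nu <= Num.sqrt C2 * Num.sqrt eps *
  Num.min (ln (E / (C2 * eps)) / p) (Num.sqrt (ln E / p)).
Hypotheses (nu_ge0 : 0 <= nu) (x_nu : forall j, `|x j| <= nu)
  (x_norm : \sum_j x j ^+ 2 <= 1).

Let C2_gt0 : 0 < C2. Proof. by rewrite /C2 invr_gt0; lra. Qed.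
Let E_gt0 : 0 < E. Proof. exact: lt_le_trans ltr01 E_ge1. Qed.
Let q_gt0 : 0 < q%:R :> R. Proof. by rewrite ltr0n ltnW. Qed.
Let p_gt0 : 0 < p. Proof. by have := q_gt0; have := qp; lra. Qed.

Let lam : R := 2 ^+ 10 * q%:R / eps.
Let th k : R := Num.sqrt (2 ^+ 7 * lam * k%:R).

Lemma lam_gt0 : 0 < lam.
Proof. by rewrite divr_gt0 // mulr_gt0 // exprn_gt0. Qed.

Lemma th_sqr k : th k ^+ 2 = 2 ^+ 7 * lam * k%:R.
Proof. by rewrite sqr_sqrtr // mulr_ge0 // mulr_ge0 // ltW // lam_gt0. Qed.

Lemma sqr_th_nu k : (th k * nu) ^+ 2 = q%:R * k%:R * (nu ^+ 2 / (4 * C2 * eps)).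
Proof.
by rewrite exprMn th_sqr /lam /C2; field; rewrite gt_eqF.
Qed.

(** Uses the first term of the minimum and k <= q <= 2 p: the square of the
left-hand side is at most q k (ln (E / (C2 eps)))^2 / (4 p^2). *)
Lemma th_nu_le_log k : (k <= q)%N -> th k * nu <= ln (E / (C2 * eps)).
Proof.
move=> kq; set Lg := ln _.
have Lg0 : 0 <= Lg.
  apply: ln_ge0; rewrite ler_pdivlMr ?mulr_gt0 // mul1r.
  apply: le_trans E_ge1.
  rewrite mulr_ile1 ?(ltW C2_gt0) ?(ltW eps_gt0) ?(ltW eps_lt1) //.
  by rewrite /C2 invf_le1 //; lra.
have nule : nu <= Num.sqrt C2 * Num.sqrt eps * (Lg / p).
  apply: le_trans nu_small _; rewrite ler_wpM2l ?mulr_ge0 ?sqrtr_ge0 //.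
  by rewrite ge_min lexx.
have nu2 : nu ^+ 2 / (4 * C2 * eps) <= (Lg / p) ^+ 2 / 4.
  rewrite ler_pdivrMr; last by rewrite !mulr_gt0.
  have : nu ^+ 2 <= (Num.sqrt C2 * Num.sqrt eps * (Lg / p)) ^+ 2.
    by rewrite lerXn2r ?nnegrE // (le_trans nu_ge0).
  rewrite !exprMn !sqr_sqrtr ?(ltW C2_gt0) ?(ltW eps_gt0) // => h.
  apply: le_trans h _; rewrite le_eqVlt; apply/orP; left; apply/eqP.
  by field; rewrite gt_eqF.
rewrite -(@ler_pXn2r _ 2%N) ?nnegrE ?mulr_ge0 ?sqrtr_ge0 // sqr_th_nu.
have k_le_q : k%:R <= q%:R :> R by rewrite ler_nat.
apply: (@le_trans _ _ ((2 * p) * (2 * p) * ((Lg / p) ^+ 2 / 4))).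
  have nn : 0 <= nu ^+ 2 / (4 * C2 * eps).
    by rewrite divr_ge0 ?sqr_ge0 // ltW // !mulr_gt0.
  apply: ler_pM => //.
  by apply: ler_pM => //; apply: le_trans qp.
by rewrite le_eqVlt; apply/orP; left; apply/eqP; field; rewrite gt_eqF.
Qed.

(** Uses the second term of the minimum: the square of th nu is at most
k ln E / 2, and a geometric mean is at most the arithmetic mean. *)
Lemma two_th_nu_le k : 2 * (th k * nu) <= k%:R + ln E.
Proof.
set Lg := ln E.
have Lg0 : 0 <= Lg by apply: ln_ge0.
have nule : nu <= Num.sqrt C2 * Num.sqrt eps * Num.sqrt (Lg / p).
  apply: le_trans nu_small _; rewrite ler_wpM2l ?mulr_ge0 ?sqrtr_ge0 //.
  by rewrite ge_min lexx orbT.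
have nu2 : nu ^+ 2 / (4 * C2 * eps) <= Lg / p / 4.
  rewrite ler_pdivrMr; last by rewrite !mulr_gt0.
  have : nu ^+ 2 <= (Num.sqrt C2 * Num.sqrt eps * Num.sqrt (Lg / p)) ^+ 2.
    by rewrite lerXn2r ?nnegrE // (le_trans nu_ge0).
  rewrite !exprMn !sqr_sqrtr ?(ltW C2_gt0) ?(ltW eps_gt0) ?divr_ge0 ?(ltW p_gt0) // => h.
  apply: le_trans h _; rewrite le_eqVlt; apply/orP; left; apply/eqP.
  by field; rewrite gt_eqF.
rewrite -(@ler_pXn2r _ 2%N) ?nnegrE ?mulr_ge0 ?sqrtr_ge0 ?addr_ge0 //.
rewrite exprMn sqr_th_nu.
have : q%:R * k%:R * (nu ^+ 2 / (4 * C2 * eps)) <= 2 * p * k%:R * (Lg / p / 4).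
  have nn : 0 <= nu ^+ 2 / (4 * C2 * eps).
    by rewrite divr_ge0 ?sqr_ge0 // ltW // !mulr_gt0.
  apply: ler_pM => //.
  by rewrite ler_wpM2r.
have -> : 2 * p * k%:R * (Lg / p / 4) = k%:R * Lg / 2.
  by field; rewrite gt_eqF.
have := sqr_ge0 (k%:R - Lg : R); have : 0 <= k%:R * Lg by rewrite mulr_ge0.
by nra.
Qed.

Lemma avg_row_weighted_le eta (i : row) k : (1 < k <= q)%N ->
  lam ^+ k / k`!%:R * avg (fun w => (part x eta i w * copart x eta i w) ^+ k) <=
  q%:R / m * 2^-1 ^+ k.
Proof.
move=> /andP[k1 kq]; have m0 : 0 < m by rewrite ltr0n.
have th0 : 0 < th k.
  by rewrite sqrtr_gt0 mulr_gt0 ?ltr0n ?(ltnW k1) // mulr_gt0 ?lam_gt0.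
apply: (@le_trans _ _ (lam ^+ k / k`!%:R * ((k`!%:R / th k ^+ k) ^+ 2 *
  (4 * (th k ^+ 2 * expR (th k * nu) / (m * 2) *
        expR (th k ^+ 2 * expR (th k * nu) / (m * 2))) ^+ 2)))).
  rewrite ler_wpM2l //; first by rewrite divr_ge0 ?exprn_ge0 // ltW // lam_gt0.
  apply: avg_row_exp_le => // j.
  by rewrite normrM (gtr0_norm th0) ler_wpM2l // ltW.
apply: (row_moment_numeric (E := E)) => //; rewrite -/C2.
- exact: ltnW.
- exact: th_sqr.
- by rewrite -[leRHS]lnK ?posrE ?divr_gt0 ?mulr_gt0 // ler_expR th_nu_le_log.
- rewrite -expRM_natl -[E]lnK ?posrE // -expRD ler_expR.
  exact: two_th_nu_le.
- apply: (@le_trans _ _ (2 * (E * C2 ^- 2 * eps ^- 2 * p))); last first.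
    by rewrite ler_wpM2l.
  rewrite [leRHS]mulrCA ler_wpM2l //.
  by rewrite !mulr_ge0 ?invr_ge0 ?exprn_ge0 // ltW.
Qed.

(** Markov's inequality for the q-th moment.  The factor 2^10 in lam is chosen
so that 4 (from decoupling), 2 / eps (from the threshold), q / lam and e^(1/2)
multiply to at most 1 / 64. *)
Lemma hashing_tail :
  avg (fun w : sample => (eps / 2 <= `|deviation x w|)%R%:R) <= 64^-1 ^+ q :> R.
Proof.
have moment : avg (fun w : sample => deviation x w ^+ q) <=
    4 ^+ q * (q`!%:R / lam ^+ q * expR (q%:R / 2)).
  apply: avg_deviation_exp_le => // eta.
  apply: avg_decoupled_exp_le => //; first exact: lam_gt0.
  by move=> i k; apply: avg_row_weighted_le.
have e2 : 0 < eps / 2 by rewrite divr_gt0.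
apply: (@le_trans _ _ (((eps / 2) ^+ q)^-1 *
    avg (fun w : sample => deviation x w ^+ q))).
  rewrite -avgZ; apply: le_avg => w.
  case: (boolP (eps / 2 <= _)%R) => [h|_] /=; last first.
    rewrite mulr0n mulr_ge0 ?exprn_even_ge0 //.
    by rewrite invr_ge0 exprn_ge0 // ltW.
  rewrite mulrC ler_pdivlMr ?exprn_gt0 // mul1r.
  have -> : deviation x w ^+ q = `|deviation x w| ^+ q.
    by rewrite -normrX ger0_norm // exprn_even_ge0.
  by rewrite lerXn2r ?nnegrE // ltW.
apply: le_trans (ler_wpM2l _ moment) _.
  by rewrite invr_ge0 exprn_ge0 // ltW.
have qq : q`!%:R <= q%:R ^+ q :> R by rewrite -natrX ler_nat fact_le_expn.
have eq2 : expR (q%:R / 2 : R) <= 2 ^+ q.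
  by rewrite expRM_natl lerXn2r ?nnegrE ?expR_ge0 // expR_half_le2.
apply: (@le_trans _ _ (((eps / 2) ^+ q)^-1 *
    (4 ^+ q * (q%:R ^+ q / lam ^+ q * 2 ^+ q)))).
  rewrite ler_wpM2l ?invr_ge0 ?exprn_ge0 ?(ltW e2) //.
  rewrite ler_wpM2l ?exprn_ge0 //.
  apply: ler_pM; rewrite ?expR_ge0 //.
    by rewrite divr_ge0 ?exprn_ge0 // ltW // lam_gt0.
  by rewrite ler_wpM2r // invr_ge0 exprn_ge0 // ltW // lam_gt0.
rewrite -!exprVn -!exprMn le_eqVlt; apply/orP; left; apply/eqP.
congr (_ ^+ _); rewrite /lam; field.
by rewrite !gt_eqF.
Qed.
End Tail.

(** * Quadratic forms on a grid of the unit ball *)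

Section Net.
Variables (R : realType) (r : nat).
Hypothesis r_gt0 : (0 < r)%N.
Notation vec := ('I_r -> R).
Notation code := {ffun 'I_r -> 'I_(16 * r).+1 * bool}.

Definition sqn (w : vec) : R := \sum_i w i ^+ 2.

Lemma sqn_ge0 w : 0 <= sqn w.
Proof. by apply: sumr_ge0 => i _; rewrite sqr_ge0. Qed.

(** Rounding each coordinate to a multiple of [mesh] moves a vector with r
coordinates by at most sqrt r * mesh = 1 / 4. *)
Definition mesh : R := (4 * Num.sqrt r%:R)^-1.

(** A code is a sign and a magnitude per coordinate.  Magnitudes up to 16 r
suffice, since their squares sum to at most 16 r in a net. *)
Definition grid_point (f : code) : vec :=
  fun i => mesh * ((-1) ^+ (f i).2 * (f i).1%:R).

Definition in_net (f : code) : bool := (\sum_i (f i).1 ^ 2 <= 16 * r)%N.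

Lemma mesh_gt0 : 0 < mesh.
Proof. by rewrite invr_gt0 mulr_gt0 // sqrtr_gt0 ltr0n. Qed.

Lemma mesh_sqr : mesh ^+ 2 * (16 * r%:R) = 1.
Proof.
rewrite /mesh exprVn exprMn sqr_sqrtr // (_ : 4 ^+ 2 = 16); last by ring.
by rewrite mulVf // mulf_neq0 // pnatr_eq0 -lt0n.
Qed.

(** Each code of the net has weight at least 1 for the product weight with
factors 2^(16 - k), because the sum of the magnitudes k is at most that of
their squares; and the total weight is a product of geometric series. *)
Lemma net_count : \sum_(f : code) (in_net f)%:R <= (2 ^+ 18) ^+ r :> R.
Proof.
apply: (@le_trans _ _ (\sum_(f : code) \prod_i (2 ^+ 16 * 2^-1 ^+ (f i).1))).
  apply: ler_sum => f _; case: (boolP (in_net f)) => [inf|_]; last first.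
    by apply: prodr_ge0 => i _; rewrite mulr_ge0 ?exprn_ge0 ?invr_ge0.
  rewrite big_split /= prodr_const card_ord -exprM prodrXr.
  rewrite exprVn ler_pdivlMr ?exprn_gt0 // mul1r ler_eXn2l ?ltr1n //.
  apply: leq_trans inf; apply: leq_sum => i _.
  by case: ((f i).1 : nat) => // k; rewrite expnS leq_pmulr.
rewrite -(bigA_distr_bigA (fun (i : 'I_r) (p : 'I_(16 * r).+1 * bool) =>
  2 ^+ 16 * 2^-1 ^+ p.1)) /= prodr_const card_ord.
apply: lerXn2r; rewrite ?nnegrE ?exprn_ge0 //.
  by apply: sumr_ge0 => p _; rewrite mulr_ge0 ?exprn_ge0 ?invr_ge0.
rewrite -(pair_big xpredT xpredT (fun (k : 'I_(16 * r).+1) (b : bool) =>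
  2 ^+ 16 * 2^-1 ^+ k)) /=.
rewrite (eq_bigr (fun k : 'I_(16 * r).+1 => 2 ^+ 17 * 2^-1 ^+ k)); last first.
  by move=> k _; rewrite big_bool /= [2 ^+ 17]exprS; ring.
rewrite -mulr_sumr [2 ^+ 18]exprSr ler_wpM2l ?exprn_ge0 //.
rewrite -(big_mkord xpredT (fun k => 2^-1 ^+ k)).
have -> : \sum_(0 <= k < (16 * r).+1) (2^-1 : R) ^+ k = 2 - 2^-1 ^+ (16 * r).
  elim: (16 * r)%N => [|n IH]; first by rewrite big_nat1 expr0; lra.
  by rewrite big_nat_recr //= IH !exprS; field.
by rewrite gerBl exprn_ge0 ?invr_ge0.
Qed.

(** Rounding towards zero keeps the point in the unit ball. *)
Lemma net_approx w : sqn w <= 1 -> exists f : code,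
  [/\ in_net f, sqn (grid_point f) <= 1 &
      sqn (fun i => w i - grid_point f i) <= 16^-1].
Proof.
move=> w1; have g0 := mesh_gt0.
pose k i := Num.truncn (`|w i| / mesh).
have kle i : mesh * (k i)%:R <= `|w i|.
  by rewrite mulrC -ler_pdivlMr // truncn_le // divr_ge0 // ltW.
have klt i : `|w i| <= mesh * (k i)%:R + mesh.
  have := truncnS_gt (`|w i| / mesh).
  by rewrite ltr_pdivrMr // => /ltW; rewrite -/(k i) -natr1 mulrDl mul1r mulrC.
have ksum : (\sum_i k i ^ 2 <= 16 * r)%N.
  rewrite -(ler_nat R) -(ler_pM2l (exprn_gt0 2 g0)) natrM mesh_sqr.
  apply: le_trans w1; rewrite natr_sum mulr_sumr; apply: ler_sum => i _.
  rewrite natrX -exprMn -[leRHS]real_normK ?num_real // lerXn2r ?nnegrE //.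
  by rewrite mulr_ge0 // ltW.
have kK i : (k i < (16 * r).+1)%N.
  rewrite ltnS; apply: leq_trans ksum; rewrite (bigD1 i) //=.
  apply: leq_trans (leq_addr _ _).
  by case: (k i) => // n; rewrite expnS leq_pmulr.
pose f : code := [ffun i => (Ordinal (kK i), w i < 0)].
have fE i : grid_point f i = mesh * ((-1) ^+ (w i < 0)%R * (k i)%:R).
  by rewrite /grid_point ffunE.
exists f; split.
- by rewrite /in_net; under eq_bigr do rewrite ffunE.
- apply: le_trans w1; apply: ler_sum => i _; rewrite fE mulrCA exprMn sqrr_sign mul1r.
  rewrite -[leRHS]real_normK ?num_real // lerXn2r ?nnegrE //.
  by rewrite mulr_ge0 // ltW.
- apply: (@le_trans _ _ (\sum_(i < r) mesh ^+ 2)).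
    apply: ler_sum => i _; rewrite fE.
    rewrite {1}[w i]numEsign mulrCA -mulrBr exprMn sqrr_sign mul1r.
    rewrite lerXn2r ?nnegrE ?(ltW g0) //; first by rewrite subr_ge0.
    by rewrite lerBlDl.
  rewrite sumr_const card_ord -mulr_natr.
  have := mesh_sqr; lra.
Qed.

Section Form.
Variable M : 'I_r -> 'I_r -> R.
Definition qform (w : vec) : R := \sum_a \sum_b M a b * (w a * w b).

Lemma qformZ t w : qform (fun i => t * w i) = t ^+ 2 * qform w.
Proof.
rewrite /qform mulr_sumr; apply: eq_bigr => a _; rewrite mulr_sumr.
by apply: eq_bigr => b _; ring.
Qed.

Lemma sqnZ t w : sqn (fun i => t * w i) = t ^+ 2 * sqn w.
Proof. by rewrite /sqn mulr_sumr; apply: eq_bigr => a _; ring. Qed.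

Lemma sqn_parallelogram v w :
  sqn (fun i => v i + w i) + sqn (fun i => v i - w i) = 2 * (sqn v + sqn w).
Proof.
by rewrite /sqn -!big_split mulr_sumr; apply: eq_bigr => a _ /=; ring.
Qed.

(** Q(w) - Q(v) is the symmetrized bilinear form at (w - v, w + v).  The
scaling by 4 and 1 / 2 brings both arguments into the unit ball when w and v
are in it and are 1 / 4 apart. *)
Lemma qform_polar v w :
  qform (fun i => 4 * (w i - v i) + 2^-1 * (w i + v i)) -
  qform (fun i => 4 * (w i - v i) - 2^-1 * (w i + v i)) = 8 * (qform w - qform v).
Proof.
rewrite /qform -!sumrB mulr_sumr; apply: eq_bigr => a _.
by rewrite -!sumrB mulr_sumr; apply: eq_bigr => b _; field.
Qed.

Lemma qform_bounded w : sqn w <= 1 -> `|qform w| <= \sum_a \sum_b `|M a b|.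
Proof.
move=> w1; have wi i : `|w i| <= 1.
  rewrite -(@ler_pXn2r _ 2%N) ?nnegrE // expr1n real_normK ?num_real //.
  apply: le_trans w1; rewrite /sqn (bigD1 i) //= lerDl.
  by apply: sumr_ge0 => k _; rewrite sqr_ge0.
apply: le_trans (ler_norm_sum _ _ _) _; apply: ler_sum => a _.
apply: le_trans (ler_norm_sum _ _ _) _; apply: ler_sum => b _.
by rewrite normrM ler_piMr // normrM mulr_ile1.
Qed.

(** If L is the supremum of |Q| on the unit ball, moving to the nearest grid
point changes Q by at most L / 2, so L <= eps / 2 + L / 2. *)
Lemma qform_net eps : (forall f, in_net f -> sqn (grid_point f) <= 1 ->
    `|qform (grid_point f)| <= eps / 2) ->
  forall w, `|qform w| <= eps * sqn w.
Proof.
move=> net_le.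
pose X := [set t | exists w, sqn w <= 1 /\ t = `|qform w|].
have X_sup : has_sup X.
  split; last by exists (\sum_a \sum_b `|M a b|) => _ [w [w1 ->]]; apply: qform_bounded.
  exists `|qform (fun=> 0)|, (fun=> 0); split => //.
  by rewrite /sqn big1 // => i _; rewrite expr0n.
set L := sup X.
have in_ball w : sqn w <= 1 -> `|qform w| <= L.
  by move=> w1; apply: sup_upper_bound => //; exists w.
(* A bound on the ball extends to all vectors by homogeneity. *)
have homog c : (forall w, sqn w <= 1 -> `|qform w| <= c) ->
    forall w, `|qform w| <= c * sqn w.
  move=> ball w; have [w0|w0] := eqVneq (sqn w) 0.
    have wz i : w i = 0.
      have /eqP := w0; rewrite psumr_eq0 => [/allP/(_ i)|k _]; last exact: sqr_ge0.
      by rewrite mem_index_enum /= sqrf_eq0 => /(_ isT)/eqP.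
    rewrite w0 mulr0 /qform big1 ?normr0 // => a _; rewrite big1 // => b _.
    by rewrite wz mul0r mulr0.
  have w_gt0 : 0 < sqn w by rewrite lt_def w0 sqn_ge0.
  set t := (Num.sqrt (sqn w))^-1.
  have t2 : t ^+ 2 = (sqn w)^-1 by rewrite exprVn sqr_sqrtr // ltW.
  have := ball (fun i => t * w i).
  rewrite sqnZ qformZ t2 mulVf // normrM ger0_norm ?invr_ge0 ?(ltW w_gt0) //.
  by move/(_ (lexx _)); rewrite mulrC ler_pdivrMr.
have half w : sqn w <= 1 -> `|qform w| <= eps / 2 + L / 2.
  move=> w1; have [f [inf v1 wv]] := net_approx w1.
  set v := grid_point f in v1 wv.
  have -> : qform w = qform v + (qform w - qform v) by ring.
  apply: le_trans (ler_normD _ _) _; apply: lerD; first exact: net_le.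
  suff : 8 * `|qform w - qform v| <= 4 * L by lra.
  rewrite -[8 in leLHS]normr_nat -normrM -qform_polar.
  apply: le_trans (ler_normB _ _) _.
  apply: le_trans (lerD (homog _ in_ball _) (homog _ in_ball _)) _.
  rewrite -mulrDr sqn_parallelogram !sqnZ mulrC ler_wpM2r //.
    apply: le_trans (in_ball (fun=> 0) _) => //.
    by rewrite /sqn big1 // => i _; rewrite expr0n.
  have := sqn_parallelogram w v.
  have := sqn_ge0 (fun i => w i - v i).
  lra.
have L_le : L <= eps.
  have : L <= eps / 2 + L / 2.
    apply: ge_sup; first by case: X_sup.
    by move=> _ [w [w1 ->]]; apply: half.
  lra.
by apply: homog => w /in_ball /le_trans; apply.
Qed.
End Form.
End Net.

(** * Compact singular value decompositions *)

Section SVD.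
Import numFieldNormedType.Exports.
Variable R : realType.

Lemma continuous_sumr (T : topologicalType) (I : Type) (s : seq I) (F : I -> T -> R) :
  (forall i, continuous (F i)) -> continuous (fun t => \sum_(i <- s) F i t).
Proof.
move=> cF t; elim: s => [|i s IH].
  under eq_fun do rewrite big_nil; exact: cvg_cst.
under eq_fun do rewrite big_cons.
by apply: cvgD; [exact: cF | exact: IH].
Qed.

Lemma quadratic_continuous d (N : 'M[R]_d) :
  continuous (fun w : 'rV[R]_d => (w *m N *m w^T) 0 0).
Proof.
rewrite (_ : (fun w : 'rV[R]_d => _) = fun w : 'rV[R]_d =>
    \sum_b (\sum_a w 0 a * N a b) * w 0 b).
  have lin b : continuous (fun w : 'rV[R]_d => \sum_a w 0 a * N a b).
    apply: continuous_sumr => a w.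
    apply: (@continuousM _ _ (fun w : 'rV[R]_d => w 0 a) (fun=> N a b)).
      exact: coord_continuous.
    exact: cst_continuous.
  apply: continuous_sumr => b w.
  apply: (@continuousM _ _ _ (fun w : 'rV[R]_d => w 0 b)); first exact: lin.
  exact: coord_continuous.
apply/funext => w; rewrite mxE; apply: eq_bigr => b _.
by rewrite !mxE.
Qed.

Lemma quadratic_max d (N : 'M[R]_d) : (0 < d)%N ->
  exists2 v : 'rV[R]_d, (v *m v^T) 0 0 = 1 &
    forall w : 'rV[R]_d, (w *m w^T) 0 0 = 1 ->
      (w *m N *m w^T) 0 0 <= (v *m N *m v^T) 0 0.
Proof.
move=> d0; pose K := [set w : 'rV[R]_d | (w *m 1%:M *m w^T) 0 0 = 1].
have KE w : K w = ((w *m w^T) 0 0 = 1) by rewrite /K /= mulmx1.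
have cK : compact K.
  have box : compact [set v : 'rV[R]_d | forall i, v ord0 i \in `[-1, 1]].
    have h := @rV_compact R d (fun=> `[-1, 1]%classic) (fun=> @segment_compact R (-1) 1).
    exact: h.
  apply: (subclosed_compact _ box).
    apply: (@preimage_closed _ _ (fun w : 'rV[R]_d => (w *m 1%:M *m w^T) 0 0) [set 1]).
      by move=> w _; apply: quadratic_continuous.
    exact: closed_eq.
  move=> w; rewrite KE mxE => w1 i.
  have : w 0 i ^+ 2 <= 1.
    rewrite -w1 (bigD1 i) //= mxE expr2 lerDl.
    by apply: sumr_ge0 => j _; rewrite mxE -expr2 sqr_ge0.
  rewrite in_itv /= -ler_norml -[leRHS](expr1n R 2) -real_normK ?num_real //.
  by rewrite ler_pXn2r ?nnegrE.
have K0 : K !=set0.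
  exists (delta_mx 0 (Ordinal d0)); rewrite KE trmx_delta mul_delta_mx.
  by rewrite mxE !eqxx.
have [v Kv vmax] := compact_EVT_max K0 cK
  (continuous_subspaceT (@quadratic_continuous d N)).
exists v; first by rewrite -KE; apply: set_mem.
by move=> w w1; apply: vmax; apply: mem_set; rewrite KE.
Qed.

Lemma sqr_row_ge0 d (w : 'rV[R]_d) : 0 <= (w *m w^T) 0 0.
Proof. by rewrite mxE; apply: sumr_ge0 => i _; rewrite mxE -expr2 sqr_ge0. Qed.

Lemma sqr_row_eq0 d (w : 'rV[R]_d) : (w *m w^T) 0 0 = 0 -> w = 0.
Proof.
rewrite mxE => /eqP; rewrite psumr_eq0 => [/allP w0|i _]; last first.
  by rewrite mxE -expr2 sqr_ge0.
apply/rowP => i; have := w0 i; rewrite mem_index_enum !mxE => /(_ isT) /=.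
by rewrite mulf_eq0 orbb => /eqP.
Qed.

(** The form at v - s z with z = v N is -2 s |z|^2 + O(s^2), which would be
negative for a small s > 0 if z were nonzero. *)
Lemma psd_kernel d (N : 'M[R]_d) (v : 'rV[R]_d) : N^T = N ->
  (forall w : 'rV[R]_d, 0 <= (w *m N *m w^T) 0 0) ->
  (v *m N *m v^T) 0 0 = 0 -> v *m N = 0.
Proof.
move=> Nsym psd v0; set z := v *m N.
apply: sqr_row_eq0; apply/eqP; rewrite eq_le sqr_row_ge0 andbT.
set a := (z *m z^T) 0 0; set c := (z *m N *m z^T) 0 0.
have c0 : 0 <= c := psd z.
have key s : 0 <= - (2 * s * a) + s ^+ 2 * c.
  have := psd (v - s *: z).
  rewrite [(v - _)^T]linearB /= [(s *: z)^T]linearZ /= !mulmxBl !mulmxBr.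
  rewrite -!scalemxAr -!scalemxAl -/z.
  have -> : z *m N *m v^T = z *m z^T by rewrite /z trmx_mul Nsym !mulmxA.
  have E (p q t u : 'M[R]_1) : (p - q - (t - u)) 0 0 =
     p 0 0 - q 0 0 - t 0 0 + u 0 0.
    by rewrite !mxE; ring.
  have S (p : 'M[R]_1) : (s *: p) 0 0 = s * p 0 0 by rewrite mxE.
  rewrite E !S v0 -/a -/c.
  by congr (0 <= _); ring.
(* This s is small enough for any c >= 0, and avoids dividing by c = 0. *)
have := key (a / (c + 1)).
have c1 : 0 < c + 1 by lra.
have -> : - (2 * (a / (c + 1)) * a) + (a / (c + 1)) ^+ 2 * c =
   - (a ^+ 2 * ((c + 2) / (c + 1) ^+ 2)) by field; rewrite gt_eqF.
rewrite oppr_ge0 pmulr_lle0; last by rewrite divr_gt0 ?exprn_gt0 //; lra.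
by move=> a2; nra.
Qed.

(** A maximizer v of |A v|^2 on the unit sphere, with maximum l, makes the form
of l I - A^T A nonnegative and zero at v, so v is in its kernel. *)
Lemma top_singular_vector n d (A : 'M[R]_(n, d)) : A != 0 ->
  exists2 v : 'rV[R]_d, v *m v^T = 1%:M &
  exists2 s : R, 0 < s & v *m (A^T *m A) = s ^+ 2 *: v.
Proof.
move=> A0.
have [j Aj] : exists j, col j A != 0.
  apply/existsP; rewrite -negb_forall; apply: contra A0 => /forallP A0.
  by apply/eqP/matrixP => i j; have /eqP/colP/(_ i) := A0 j; rewrite !mxE.
have d0 : (0 < d)%N by apply: leq_ltn_trans (ltn_ord j).
set N := A^T *m A.
have NA (w : 'rV[R]_d) : w *m N *m w^T = (w *m A^T) *m (w *m A^T)^T.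
  by rewrite trmx_mul trmxK !mulmxA.
have [v v1 vmax] := quadratic_max N d0.
set l := (v *m N *m v^T) 0 0 in vmax.
have l0 : 0 < l.
  pose e : 'rV[R]_d := delta_mx 0 j.
  apply: lt_le_trans (vmax e _); last first.
    by rewrite trmx_delta mul_delta_mx mxE !eqxx.
  rewrite lt_def NA sqr_row_ge0 andbT; apply: contra Aj => /eqP /sqr_row_eq0.
  by rewrite -rowE -tr_col => /(congr1 trmx); rewrite trmxK trmx0 => ->.
have v11 : v *m v^T = 1%:M.
  by apply/matrixP => i k; rewrite !ord1 v1 mxE eqxx.
exists v => //; exists (Num.sqrt l); first by rewrite sqrtr_gt0.
rewrite sqr_sqrtr ?(ltW l0) //.
have ball (w : 'rV[R]_d) : (w *m N *m w^T) 0 0 <= l * (w *m w^T) 0 0.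
  have [w0|w0] := eqVneq ((w *m w^T) 0 0) 0.
    by rewrite w0 mulr0 (sqr_row_eq0 w0) !mul0mx mxE.
  have w_gt0 : 0 < (w *m w^T) 0 0 by rewrite lt_def w0 sqr_row_ge0.
  set t := (Num.sqrt ((w *m w^T) 0 0))^-1.
  have t2 : t * t = ((w *m w^T) 0 0)^-1 by rewrite -expr2 exprVn sqr_sqrtr // ltW.
  have := vmax (t *: w).
  rewrite [(t *: w)^T]linearZ /= -!scalemxAl -!scalemxAr !scalerA t2.
  have S (a : R) (p : 'M[R]_1) : (a *: p) 0 0 = a * p 0 0 by rewrite mxE.
  by rewrite !S mulVf // => /(_ erefl); rewrite mulrC ler_pdivrMr.
have : v *m (l%:M - N) = 0.
  have quad (w : 'rV[R]_d) : (w *m (l%:M - N) *m w^T) 0 0 =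
      l * (w *m w^T) 0 0 - (w *m N *m w^T) 0 0.
    by rewrite mulmxBr mulmxBl mul_mx_scalar -scalemxAl !mxE.
  apply: psd_kernel.
  - by rewrite linearB /= tr_scalar_mx trmx_mul trmxK.
  - by move=> w; rewrite quad subr_ge0.
  - by rewrite quad v1 mulr1 subrr.
by rewrite mulmxBr mul_mx_scalar => /eqP; rewrite subr_eq0 => /eqP <-.
Qed.

(** Used to transfer orthogonality from U' Sigma' to U'. *)
Lemma mulmx_diag_gt0_eq0 p r (X : 'M[R]_(p, r)) (Sigma : 'M[R]_r) :
  is_diag_mx Sigma -> (forall i, 0 < Sigma i i) -> X *m Sigma = 0 -> X = 0.
Proof.
move=> /is_diag_mxP dS S0 /matrixP XS; apply/matrixP => i j.
have := XS i j; rewrite !mxE (bigD1 j) //= big1 ?addr0 => [|k kj]; last first.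
  by rewrite dS ?mulr0 //; apply: contraNneq kj => /val_inj ->.
by move/eqP; rewrite mulf_eq0 (gt_eqF (S0 j)) orbF => /eqP.
Qed.

(** Subtracting the top singular component s u^T v lowers the rank, and the
remainder B satisfies u B = 0 and B v^T = 0, which makes u and v orthogonal
to the singular vectors of B. *)
Lemma compact_svd_any n d (A : 'M[R]_(n, d)) :
  exists r U Sigma V, @compact_svd R n d r A U Sigma V.
Proof.
have [k] := ubnP (\rank A); elim: k A => // k IH A rk.
have [A0|A0] := eqVneq A 0.
  exists 0%N, 0, 0, 0; split; first by rewrite A0 !mul0mx.
  - by apply/matrixP => -[].
  - by apply/matrixP => -[].
  - by apply/is_diag_mxP => -[].
  - by case.
have [v vv [s s0 vN]] := top_singular_vector A0.
pose u := s^-1 *: (v *m A^T).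
have uA : u *m A = s *: v.
  rewrite /u -scalemxAl -mulmxA vN scalerA expr2 mulrA mulVf ?gt_eqF //.
  by rewrite mul1r.
have uu : u *m u^T = 1%:M.
  rewrite {2}/u linearZ /= trmx_mul trmxK -scalemxAr mulmxA uA -scalemxAl vv.
  by rewrite scalerA mulVf ?gt_eqF // scale1r.
have Av : A *m v^T = s *: u^T.
  by rewrite /u linearZ /= scalerA divff ?gt_eqF // scale1r trmx_mul trmxK.
pose B := A - s *: (u^T *m v).
have uB : u *m B = 0.
  by rewrite mulmxBr uA -scalemxAr mulmxA uu mul1mx subrr.
have Bv : B *m v^T = 0.
  by rewrite mulmxBl Av -scalemxAl -mulmxA vv mulmx1 subrr.
have rB : (\rank B < k)%N.
  rewrite ltnS in rk; apply: leq_trans rk.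
  have BA : (B <= A)%MS.
    have -> : B = (1%:M - u^T *m u) *m A.
      by rewrite mulmxBl mul1mx -mulmxA uA -scalemxAr.
    exact: submxMl.
  suff : (B < A)%MS by rewrite ltmxErank => /andP[].
  rewrite /ltmx BA /=; apply/negP => AB.
  have vA : (v <= A)%MS.
    by rewrite -[v](scalerK (lt0r_neq0 s0)) -uA scalemx_sub // submxMl.
  have /submxP[D vD] := submx_trans vA AB.
  move: vv; rewrite {1}vD -mulmxA Bv mulmx0 => /matrixP/(_ 0 0)/eqP.
  by rewrite !mxE eqxx eq_sym oner_eq0.
have [r [U [Sigma [V [BE UU VV dS S0]]]]] := IH B rB.
have uU : u *m U = 0.
  apply: (mulmx_diag_gt0_eq0 dS S0).
  have : u *m B *m V = 0 by rewrite uB mul0mx.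
  by rewrite BE !mulmxA -mulmxA VV mulmx1.
have vV : v *m V = 0.
  apply: (mulmx_diag_gt0_eq0 dS S0).
  have : (B *m v^T)^T *m U = 0 by rewrite Bv trmx0 mul0mx.
  rewrite trmx_mul trmxK BE !trmx_mul trmxK -!mulmxA UU mulmx1.
  have -> // : Sigma^T = Sigma.
  apply/matrixP => i j; rewrite mxE; have [->//|ij] := eqVneq i j.
  by have /is_diag_mxP dS' := dS; rewrite !dS' // eq_sym.
exists (1 + r)%N, (row_mx u^T U), (block_mx s%:M 0 0 Sigma), (row_mx v^T V); split.
- rewrite tr_row_mx trmxK mul_row_block mul_row_col !mulmx0 addr0 add0r.
  by rewrite mul_mx_scalar -scalemxAl -BE /B addrC subrK.
- rewrite tr_row_mx trmxK mul_col_row uu UU uU -[U^T *m u^T]trmxK trmx_mul !trmxK uU.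
  by rewrite trmx0 -scalar_mx_block.
- rewrite tr_row_mx trmxK mul_col_row vv VV vV -[V^T *m v^T]trmxK trmx_mul !trmxK vV.
  by rewrite trmx0 -scalar_mx_block.
- by rewrite is_diag_block_mx // scalar_mx_is_diag !eqxx dS.
- move=> i; case: (split_ordP i) => j ->.
    by rewrite block_mxEul mxE eqxx.
  by rewrite block_mxEdr.
Qed.

Lemma compact_svd_rank n d r (A : 'M[R]_(n, d)) U Sigma V :
  @compact_svd R n d r A U Sigma V -> \rank A = r.
Proof.
case=> AE UU VV dS S0; apply/eqP; rewrite eqn_leq; apply/andP; split.
  rewrite AE -mulmxA; apply: leq_trans (mxrankM_maxl _ _) _.
  exact: rank_leq_col.
have SE : Sigma = U^T *m A *m V.
  by rewrite AE !mulmxA UU mul1mx -mulmxA VV mulmx1.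
have : \rank Sigma = r.
  apply: mxrank_unit; rewrite unitmxE det_trig ?is_diag_mx_is_trig // unitfE.
  by apply/prodf_neq0 => i _; rewrite gt_eqF.
move=> {1}<-; rewrite SE; apply: leq_trans (mxrankM_maxl _ _) _.
exact: mxrankM_maxr.
Qed.

(** The existence of a decomposition rules out the default value in the
definition of the coherence. *)
Lemma coherenceP n d (A : 'M[R]_(n, d)) :
  exists U Sigma V, @compact_svd R n d (\rank A) A U Sigma V /\
    coherence A = max_row_norm U.
Proof.
rewrite /coherence; case: xgetP => [mu _ /= muE|]; first by [].
have [r [U [Sigma [V svd]]]] := compact_svd_any A.
have rE := compact_svd_rank svd; case: r / rE U Sigma V svd => U Sigma V svd.
by move/(_ (max_row_norm U)) => []; exists U, Sigma, V.
Qed.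
End SVD.

(** * From the random matrix to a finite average *)

Definition hashing_mx (R : realType) (m n : nat)
    (w : {ffun 'I_n -> 'I_m * bool}) : 'M[R]_(m, n) :=
  \matrix_(i, j) (if i == (w j).1 then (-1) ^+ (w j).2 else 0).

(** The sampled indices and signs take finitely many values, all equally likely
by the product rule, so the event is a finite disjoint union of fibers of the
same probability. *)
Lemma hashing1_avg (R : realType) (disp : measure_display)
    (T : measurableType disp) (P : probability T R) (m n : nat)
    (S : T -> 'M[R]_(m, n)) (Q : 'M[R]_(m, n) -> Prop) :
  hashing1 P S ->
  P [set t | Q (S t)] =
    (avg (fun w => (`[< Q (hashing_mx R w) >])%:R))%:E.
Proof.
move=> [h [s [[mh ms] Ph Ps indep SE]]].
pose W t : {ffun 'I_n -> 'I_m * bool} := [ffun j => (h j t, s j t)].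
have SW t : S t = hashing_mx R (W t).
  by rewrite SE; apply/matrixP => i j; rewrite !mxE ffunE.
pose fiber (w : {ffun 'I_n -> 'I_m * bool}) := \bigcap_(j in [set: 'I_n])
  (h j @^-1` [set (w j).1] `&` s j @^-1` [set (w j).2]).
have fiberE w t : fiber w t <-> W t = w.
  split=> [ft|<- j _]; last by rewrite ffunE.
  by apply/ffunP => j; rewrite ffunE; have [/= -> ->] := ft j I; case: (w j).
have mfiber w : measurable (fiber w).
  apply: fin_bigcap_measurable => [|j _]; first exact: finite_finset.
  exact: measurableI.
have Pfiber w : P (fiber w) = ((#|{: {ffun 'I_n -> 'I_m * bool}}|%:R : R)^-1)%:E.
  rewrite /fiber indep.
  under eq_bigr do rewrite Ph Ps -EFinM.
  rewrite prodEFin prodr_const card_ord; congr (_%:E).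
  rewrite card_ffun card_prod card_bool !card_ord natrX natrM exprMn exprVn.
  by rewrite exprVn -invfM exprMn.
pose good := [seq w <- index_enum {ffun 'I_n -> 'I_m * bool} | `[< Q (hashing_mx R w) >]].
have -> : [set t | Q (S t)] = \bigcup_(w in [set` good]) fiber w.
  apply/seteqP; split => t /=.
    move=> Qt; exists (W t); last by apply/fiberE.
    by rewrite /= mem_filter mem_index_enum andbT; apply/asboolP; rewrite -SW.
  move=> [w /=]; rewrite mem_filter => /andP[/asboolP Qw _] /fiberE Wt.
  by rewrite SW Wt.
rewrite measure_fin_bigcup //; first last.
  apply/trivIsetP => w w' _ _ ww'; apply/seteqP; split=> // t [/fiberE tw /fiberE tw'].
  by case/eqP: ww'; rewrite -tw -tw'.
rewrite -fsbig_seq ?filter_uniq ?index_enum_uniq //.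
rewrite /good big_filter.
transitivity (\sum_(w : {ffun 'I_n -> 'I_m * bool} | `[< Q (hashing_mx R w) >])
    ((#|{: {ffun 'I_n -> 'I_m * bool}}|%:R : R)^-1)%:E)%E.
  by apply: eq_bigr => w _; apply: Pfiber.
rewrite sumEFin; congr (_%:E).
rewrite /avg big_mkcond mulr_suml; apply: eq_bigr => w _.
by case: ifP => _; rewrite ?mul1r ?mul0r.
Qed.

(** * The embedding *)

Section Assembly.
Variable R : realType.

Lemma cauchy_schwarz_sum (I : finType) (a b : I -> R) :
  (\sum_i a i * b i) ^+ 2 <= (\sum_i a i ^+ 2) * (\sum_i b i ^+ 2).
Proof.
have : 0 <= \sum_i \sum_j (a i * b j - a j * b i) ^+ 2.
  by apply: sumr_ge0 => i _; apply: sumr_ge0 => j _; rewrite sqr_ge0.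
have -> : \sum_i \sum_j (a i * b j - a j * b i) ^+ 2 =
  2 * ((\sum_i a i ^+ 2) * (\sum_i b i ^+ 2) - (\sum_i a i * b i) ^+ 2).
  have ab (f g : I -> R) : (\sum_i f i) * (\sum_i g i) = \sum_i \sum_j f i * g j.
    by rewrite mulr_suml; apply: eq_bigr => i _; rewrite mulr_sumr.
  transitivity ((\sum_i a i ^+ 2) * (\sum_i b i ^+ 2)
    + (\sum_i b i ^+ 2) * (\sum_i a i ^+ 2)
    - 2 * ((\sum_i a i * b i) * (\sum_i a i * b i))); last by ring.
  rewrite !ab mulr_sumr -big_split -sumrB; apply: eq_bigr => i _ /=.
  by rewrite mulr_sumr -big_split -sumrB; apply: eq_bigr => j _ /=; ring.
by rewrite pmulr_rge0 // subr_ge0.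
Qed.

Lemma norm2_sqr p q (x : 'M[R]_(p, q)) :
  norm2 x ^+ 2 = \sum_i \sum_j x i j ^+ 2.
Proof.
rewrite sqr_sqrtr //; apply: sumr_ge0 => i _; apply: sumr_ge0 => j _.
exact: sqr_ge0.
Qed.

Section Embedding.
Variables (m n r : nat) (U : 'M[R]_(n, r)).
Hypothesis UU : U^T *m U = 1%:M.

Definition lift_vec (w : 'I_r -> R) (j : 'I_n) : R := \sum_a U j a * w a.

Lemma sum_lift_sqr w : \sum_j lift_vec w j ^+ 2 = sqn w.
Proof.
pose c := \col_a w a.
have -> : \sum_j lift_vec w j ^+ 2 = ((U *m c)^T *m (U *m c)) 0 0.
  rewrite mxE; apply: eq_bigr => j _; rewrite !mxE -expr2; congr (_ ^+ 2).
  by apply: eq_bigr => a _; rewrite mxE.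
rewrite trmx_mul mulmxA -(mulmxA c^T) UU mulmx1 mxE.
by apply: eq_bigr => a _; rewrite !mxE.
Qed.

(** Cauchy-Schwarz with the j-th row of U. *)
Lemma lift_le w j : sqn w <= 1 -> `|lift_vec w j| <= max_row_norm U.
Proof.
move=> w1; apply: (@le_trans _ _ (norm2 (row j U))); last first.
  by rewrite /max_row_norm (le_bigmax _ (fun i => norm2 (row i U))).
rewrite -(@ler_pXn2r _ 2%N) ?nnegrE ?sqrtr_ge0 // real_normK ?num_real //.
rewrite norm2_sqr big_ord1; apply: le_trans (cauchy_schwarz_sum _ _) _.
under [leRHS]eq_bigr do rewrite mxE.
by rewrite ler_piMr // sumr_ge0 // => a _; rewrite sqr_ge0.
Qed.

Lemma sqr_sum_form (c w : 'I_r -> R) :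
  (\sum_a c a * w a) ^+ 2 = \sum_a \sum_b c a * c b * (w a * w b).
Proof.
rewrite expr2 mulr_suml; apply: eq_bigr => a _.
by rewrite mulr_sumr; apply: eq_bigr => b _; ring.
Qed.

Variable h : {ffun 'I_n -> 'I_m * bool}.

Lemma hashing_mx_sqr (x : 'cV[R]_n) :
  norm2 (hashing_mx R h *m x) ^+ 2 - norm2 x ^+ 2 = deviation (x^~ 0) h.
Proof.
rewrite !norm2_sqr /deviation; congr (_ - _).
  apply: eq_bigr => i _; rewrite big_ord1 mxE; congr (_ ^+ 2).
  apply: eq_bigr => j _; rewrite mxE /entry eq_sym.
  by case: ifP; rewrite ?mul0r.
by apply: eq_bigr => i _; rewrite big_ord1.
Qed.

Lemma deviation_qform : exists M, forall w, deviation (lift_vec w) h = qform M w.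
Proof.
pose c i a := \sum_j (hashing_mx R h) i j * U j a.
exists (fun a b => \sum_i c i a * c i b - \sum_j U j a * U j b) => w.
rewrite /deviation /qform.
have -> : \sum_i (\sum_j entry (lift_vec w) i j (h j)) ^+ 2 =
   \sum_a \sum_b (\sum_i c i a * c i b) * (w a * w b).
  under [RHS]eq_bigr do (under eq_bigr do rewrite mulr_suml; rewrite exchange_big /=).
  rewrite exchange_big /=; apply: eq_bigr => i _; rewrite -sqr_sum_form.
  congr (_ ^+ 2); rewrite /c.
  under [RHS]eq_bigr do rewrite mulr_suml.
  rewrite exchange_big /=; apply: eq_bigr => j _; rewrite mxE /entry eq_sym.
  case: ifP => _; last by rewrite big1 // => a _; rewrite !mul0r.
  by rewrite /lift_vec mulr_sumr; apply: eq_bigr => a _; rewrite mulrA.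
have -> : \sum_j lift_vec w j ^+ 2 =
   \sum_a \sum_b (\sum_j U j a * U j b) * (w a * w b).
  under [RHS]eq_bigr do (under eq_bigr do rewrite mulr_suml; rewrite exchange_big /=).
  rewrite exchange_big /=; apply: eq_bigr => j _; by rewrite -sqr_sum_form.
rewrite -sumrB; apply: eq_bigr => a _; rewrite -sumrB; apply: eq_bigr => b _.
by rewrite mulrBl.
Qed.

Lemma net_subspace_embedding d (A : 'M[R]_(n, d)) (B : 'M[R]_(r, d)) eps :
  (0 < r)%N -> A = U *m B ->
  (forall f, in_net f -> sqn (grid_point R f : 'I_r -> R) <= 1 ->
     `|deviation (lift_vec (grid_point R f)) h| <= eps / 2) ->
  subspace_embedding eps (hashing_mx R h) A.
Proof.
move=> r0 AE net_le y [z yE].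
pose w a := (B *m z) a 0.
have yw : (y^~ 0) = lift_vec w.
  by apply/funext => j; rewrite yE AE -mulmxA mxE.
have [M ME] := deviation_qform.
have yn : norm2 y ^+ 2 = sqn w.
  rewrite norm2_sqr -sum_lift_sqr -yw; apply: eq_bigr => j _.
  by rewrite big_ord1.
have : `|deviation (lift_vec w) h| <= eps * norm2 y ^+ 2.
  rewrite yn ME; apply: (qform_net r0) => f inf f1.
  by rewrite -ME; apply: net_le.
rewrite -yw -hashing_mx_sqr ler_norml => /andP[lo hi].
by apply/andP; split; lra.
Qed.
End Embedding.

(** 64^q = 16^q 4^q; the first factor is at least 2^(16 r) as q >= 4 r, and the
second at least e^q >= e^(4 r) / delta >= 2^(4 r) / delta. *)
Lemma union_bound_numeric (r q : nat) (delta : R) : 0 < delta ->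
  4 * r%:R + ln (1 / delta) <= q%:R -> (4 * r <= q)%N ->
  (2 ^+ 18) ^+ r * 64^-1 ^+ q <= delta.
Proof.
move=> d0 pq rq.
have e1 : expR (4 * r%:R + ln (1 / delta)) <= 4 ^+ q.
  apply: (@le_trans _ _ (expR q%:R)); first by rewrite ler_expR.
  rewrite -[q%:R]mulr1 expRM_natl lerXn2r ?nnegrE ?expR_ge0 //.
  exact: expR1_le4.
have e2 : 2 ^+ (4 * r) <= expR (4 * r%:R) :> R.
  rewrite -natrM -[(4 * r)%:R]mulr1 expRM_natl lerXn2r ?nnegrE ?expR_ge0 //.
  by have := expR_ge1Dx (1 : R); lra.
rewrite expRD lnK ?posrE ?divr_gt0 // div1r in e1.
have e3 : 2 ^+ (4 * r) <= 4 ^+ q * delta.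
  by rewrite -ler_pdivrMr //; apply: le_trans e1; rewrite ler_wpM2r // invr_ge0 ltW.
rewrite exprVn ler_pdivrMr ?exprn_gt0 //.
have -> : 64 = 2 ^+ 4 * 4 :> R by ring.
rewrite [leRHS]mulrC [(2 ^+ 4 * 4) ^+ q]exprMn -mulrA -!exprM.
apply: (@le_trans _ _ (2 ^+ (4 * q) * 2 ^+ (4 * r))); last first.
  by rewrite ler_wpM2l ?exprn_ge0.
rewrite -exprD ler_eXn2l ?ltr1n //.
apply: (@leq_trans (4 * (4 * r) + 4 * r)).
  by rewrite mulnA -mulnDl leq_mul2r orbT.
by rewrite leq_add2r leq_mul2l.
Qed.
End Assembly.

Theorem theorem2 (R : realType) :
  exists C C1 C2 : R, [/\ 0 < C, 0 < C1, 0 < C2 &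
    forall (eps delta : R) (r d n m : nat) (E : R),
      0 < eps < 1 -> 0 < delta < 1 ->
      (0 < r)%N -> (r <= d)%N -> (d <= n)%N -> (0 < m)%N -> (m <= n)%N ->
      0 < E ->
      C <= E ->
      E <= 2 * expR (4 * r%:R) / ((4 * r%:R + ln (1 / delta)) * delta) ->
      E * C2 ^- 2 * eps ^- 2 * (4 * r%:R + ln (1 / delta)) <= m%:R ->
      forall A : 'M[R]_(n, d),
        \rank A = r ->
        coherence A <= mu_bar C1 C2 E eps delta r ->
        forall (disp : measure_display) (T : measurableType disp)
               (P : probability T R) (S : T -> 'M[R]_(m, n)),
          hashing1 P S ->
          ((1 - delta)%:E <= P [set w | subspace_embedding eps (S w) A])%E].
Proof.
exists 1, 1, (2 ^+ 19)^-1; split => //.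
move=> eps delta r d n m E /andP[e0 e1] /andP[d0 d1] r0 _ _ m0 _ _ E1 _ mE A rA.
have [U [Sigma [V [[AE UU _ _ _] ->]]]] := coherenceP A.
case: r / rA r0 mE => r0 mE; set r := \rank A in U Sigma V UU AE r0 mE *.
rewrite /mu_bar; set p := 4 * r%:R + ln (1 / delta) in mE *.
rewrite mul1r => nuE disp T P S hS.
rewrite (hashing1_avg (fun M => subspace_embedding eps M A) hS) lee_fin.
have p4r : 4 * r%:R <= p.
  by rewrite lerDl ln_ge0 // div1r invf_ge1 // ltW.
have p4 : 4 <= p.
  by apply: le_trans p4r; rewrite ler_peMr // ler1n.
(* Even, and between p and 2 p because p >= 4. *)
pose q := (2 * Num.truncn p)%N.
have p0 : 0 <= p by lra.
have tp : (Num.truncn p)%:R <= p by rewrite truncn_le.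
have pt : p < (Num.truncn p).+1%:R := truncnS_gt p.
have t1 : (0 < Num.truncn p)%N.
  by rewrite truncn_gt0; lra.
have qE : q%:R = 2 * (Num.truncn p)%:R :> R by rewrite natrM.
have pq : p <= q%:R.
  rewrite qE; apply: le_trans (ltW pt) _.
  by rewrite -natrM ler_nat mul2n -addnn -addn1 leq_add2l.
have qp : q%:R <= 2 * p by rewrite qE ler_wpM2l.
have q1 : (1 < q)%N by rewrite /q mul2n -addnn (leq_add t1 t1).
have rq : (4 * r <= q)%N by rewrite -(ler_nat R) natrM; apply: le_trans pq.
have row0 : (0 < #|'I_m|)%N by rewrite card_ord.
set emb := fun h : {ffun 'I_n -> 'I_m * bool} => _.
pose x (f : {ffun 'I_r -> 'I_(16 * r).+1 * bool}) := lift_vec U (grid_point R f).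
pose bad f (h : {ffun 'I_n -> 'I_m * bool}) := (eps / 2 <= `|deviation (x f) h|)%R.
pose good_code (f : {ffun 'I_r -> 'I_(16 * r).+1 * bool}) :=
  in_net f && (sqn (grid_point R f : 'I_r -> R) <= 1).
have bad_le f : good_code f -> avg (fun h => (bad f h)%:R) <= 64^-1 ^+ q :> R.
  move=> /andP[_ f1].
  apply: (hashing_tail row0 (E := E) (p := p) (nu := max_row_norm U)) => //.
  - by rewrite /q oddM.
  - by rewrite card_ord.
  - exact: bigmax_ge_id.
  - by move=> j; apply: lift_le.
  - by rewrite sum_lift_sqr.
have h0 : (0 < #|{: {ffun 'I_n -> 'I_m * bool}}|)%N.
  by rewrite card_ffun card_prod card_bool card_ord expn_gt0 muln_gt0 m0.
apply: (@le_trans _ _ (avg (fun h => 1 - \sum_(f | good_code f) (bad f h)%:R))).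
  rewrite (eq_avg (G := fun h => 1 + (-1) * \sum_(f | good_code f) (bad f h)%:R)).
    rewrite avgD avg_cst // avgZ avg_sum mulN1r lerD2l lerN2.
    apply: le_trans (ler_sum _ bad_le) _.
    rewrite sumr_const -[leLHS]mulr_natl; apply: le_trans (union_bound_numeric d0 pq rq).
    rewrite ler_wpM2r ?exprn_ge0 ?invr_ge0 //.
    apply: le_trans (net_count R r).
    rewrite -sum1_card natr_sum big_mkcond; apply: ler_sum => f _.
    by rewrite unfold_in /good_code; case: (in_net f) => //=; case: ifP.
  by move=> h; rewrite mulN1r.
apply: le_avg => h; rewrite /emb.
case: (boolP `[< _ >]) => [_|/asboolPn nemb].
  by rewrite lerBlDr lerDl sumr_ge0.
have [f gf bf] : exists2 f, good_code f & bad f h.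
  apply: contra_notP nemb => nbad.
  apply: (net_subspace_embedding UU (B := Sigma *m V^T)) => //.
    by rewrite mulmxA.
  move=> f inf f1; rewrite leNgt; apply/negP => lt.
  by apply: nbad; exists f; rewrite /good_code ?inf //; apply: ltW.
by rewrite subr_le0 (bigD1 f) //= bf lerDl sumr_ge0.
Qed.
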